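(* For every integer $n\geq 2$ we have \[ t_{k,n} = \frac{(n-1)\log_2(2k)-\log_2 (n-1)!}{H_{n-1}} + o_n^{k\to\infty}(1), \] where $o_n^{k\to\infty}(1)$ denotes a quantity depending on $k$ and $n$ that tends to $0$ as $k\to\infty$ for every fixed $n$.
   Context: For a finite set $A\subset\mathbb{Z}^d$ and an integer $k\geq 2$, \[ P_k(A) := \big|\big\{(a,h_1,\ldots,h_k)\in(\mathbb{Z}^d)^{k+1} : a+\epsilon_1h_1+\cdots+\epsilon_kh_k\in A \text{ for every } (\epsilon_1,\ldots,\epsilon_k)\in\{0,1\}^k\big\}\big|. \] For integers $k,n\geq 2$, $t_{k,n}$ denotes the smallest number $t>0$ such that $P_k(A)\leq|A|^t$ holds for every positive integer $d$ and every subset $A$ of $\{0,1,2,\ldots,n-1\}^d$ (such a smallest number exists). For $m\in\{1,2,3,\ldots\}$, \[ H_m := -\sum_{j=0}^m \frac{\binom{m}{j}}{2^m}\log_2\frac{\binom{m}{j}}{2^m} \] is the (base-2) Shannon entropy of the symmetric binomial distribution $B(m,1/2)$. *)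

(* Defs.v *)
From HB Require Import structures.
From mathcomp Require Import all_boot all_order all_algebra.
From mathcomp Require Import finmap.
From mathcomp Require Import all_classical all_reals all_analysis.
Set Implicit Arguments.
Unset Strict Implicit.
Unset Printing Implicit Defensive.
Import Order.TTheory GRing.Theory Num.Theory.
Import numFieldNormedType.Exports.
Local Open Scope classical_set_scope.
Local Open Scope ring_scope.

Definition cubes (d k : nat) (A : {fset 'rV[int]_d}) :
    set ('rV[int]_d * {ffun 'I_k -> 'rV[int]_d}) :=
  [set ah : 'rV[int]_d * {ffun 'I_k -> 'rV[int]_d} |
     forall eps : {ffun 'I_k -> bool},
       ah.1 + \sum_(i < k) ah.2 i *+ eps i \in A].

(* [fset_set] sends infinite sets to the empty set; [finite_cubes] below shows
   that this default is never used. *)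
Definition num_cubes (d k : nat) (A : {fset 'rV[int]_d}) : nat :=
  #|` fset_set (@cubes d k A)|.

Definition in_grid (d n : nat) (A : {fset 'rV[int]_d}) : Prop :=
  forall x, x \in A -> forall i : 'I_d, 0 <= x ord0 i < n%:Z.

Definition admissible (R : realType) (k n : nat) : set R :=
  [set s | 0 < s /\ forall (d : nat) (A : {fset 'rV[int]_d}),
     (0 < d)%N -> in_grid n A -> (num_cubes k A)%:R <= (#|` A|)%:R `^ s].

Arguments admissible R k n : clear implicits.

(* The infimum is attained: see [least_exponentP]. *)
Definition least_exponent (R : realType) (k n : nat) : R := inf (admissible R k n).
Arguments least_exponent R k n : clear implicits.

Definition log2 (R : realType) (x : R) : R := ln x / ln 2.

Definition binomial_entropy (R : realType) (m : nat) : R :=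
  - \sum_(0 <= j < m.+1)
      'C(m, j)%:R / 2 ^+ m * log2 ('C(m, j)%:R / 2 ^+ m).
Arguments binomial_entropy R m : clear implicits.

Lemma cubes_base d k (A : {fset 'rV[int]_d}) ah :
  @cubes d k A ah -> ah.1 \in A /\ forall i, ah.1 + ah.2 i \in A.
Proof.
move=> c; split.
  have := c [ffun=> false]; rewrite big1 ?addr0// => i _.
  by rewrite ffunE mulr0n.
move=> i; have := c [ffun j => j == i].
rewrite (bigD1 i)//= big1 ?addr0 ?ffunE ?eqxx ?mulr1n// => j /negbTE ji.
by rewrite ffunE ji mulr0n.
Qed.

Definition cube_of d k (A : {fset 'rV[int]_d}) (z : A * {ffun 'I_k -> A}) :
    'rV[int]_d * {ffun 'I_k -> 'rV[int]_d} :=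
  (val z.1, [ffun i => val (z.2 i) - val z.1]).

Lemma cubes_sub d k (A : {fset 'rV[int]_d}) :
  @cubes d k A `<=` [set` [fset cube_of z | z : A * {ffun 'I_k -> A}]%fset].
Proof.
move=> [a h] /cubes_base /= [aA hA]; apply/imfsetP => /=.
exists ([` aA]%fset, [ffun i => [` hA i]%fset]) => //.
congr pair; apply/ffunP => i; rewrite !ffunE /=.
by rewrite addrC addKr.
Qed.

Lemma finite_cubes d k (A : {fset 'rV[int]_d}) : finite_set (@cubes d k A).
Proof. by apply: sub_finite_set (@cubes_sub d k A) _; exact: finite_fset. Qed.

Lemma num_cubes_le d k (A : {fset 'rV[int]_d}) : (num_cubes k A <= #|` A| ^ k.+1)%N.
Proof.
have /fsubset_leq_card/leq_trans : (fset_set (@cubes d k A) `<=`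
    [fset cube_of z | z : A * {ffun 'I_k -> A}])%fset.
  apply/fsubsetP => x; rewrite in_fset_set; last exact: finite_cubes.
  by rewrite inE => /(@cubes_sub d k A).
apply; apply: leq_trans (leq_imfset_card _ _ _) _ => /=.
by rewrite -cardE card_prod card_ffun card_ord -cardfE expnS.
Qed.

Lemma num_cubes_ge d k (A : {fset 'rV[int]_d}) : (#|` A| <= num_cubes k A)%N.
Proof.
pose f (a : 'rV[int]_d) := (a, [ffun=> 0] : {ffun 'I_k -> 'rV[int]_d}).
have f_inj : injective f by move=> x y [].
have <- : #|` [fset f x | x in A]%fset| = #|` A| by rewrite card_imfset.
apply: fsubset_leq_card.
apply/fsubsetP => _ /imfsetP[a /= aA ->].
rewrite in_fset_set; last exact: finite_cubes.
rewrite inE => eps /=; rewrite big1 ?addr0// => i _.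
by rewrite ffunE mul0rn.
Qed.

Lemma least_exponentP (R : realType) (k n : nat) : (2 <= n)%N ->
  admissible R k n (least_exponent R k n) /\
  lbound (admissible R k n) (least_exponent R k n).
Proof.
move=> n2.
have adm0 : admissible R k n !=set0.
  exists k.+1%:R; split => // d A _ _.
  by rewrite powR_mulrn// -natrX ler_nat num_cubes_le.
have lb1 : lbound (admissible R k n) 1.
  move=> s [s0 /(_ 1%N [fset 0; const_mx 1]%fset isT) adm].
  have /negbTE e01 : (0 : 'rV[int]_1) != const_mx 1.
    by apply/eqP => /rowP/(_ ord0); rewrite !mxE.
  have {adm} : (num_cubes k [fset (0 : 'rV[int]_1); const_mx 1]%fset)%:R
      <= (#|` [fset (0 : 'rV[int]_1); const_mx 1]%fset|)%:R `^ s.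
    apply: adm => x.
    by rewrite !inE => /orP[]/eqP-> i; rewrite !mxE//= ltz_nat (leq_trans _ n2).
  have := num_cubes_ge k [fset (0 : 'rV[int]_1); const_mx 1]%fset.
  rewrite -(ler_nat R) => /le_trans/[apply].
  rewrite cardfs2 e01 /= -ler_ln ?posrE ?powR_gt0// ln_powR.
  have l2 : 0 < ln (2 : R) by rewrite ln_gt0 ?ltr1n.
  by rewrite -[X in X <= _]mul1r ler_pM2r.
split; last by apply: ge_inf; exists 1.
have t1 : 1 <= least_exponent R k n by exact: lb_le_inf.
split; first exact: lt_le_trans t1.
move=> d A d0 gA; have [A0|A1|A1] := ltngtP #|` A| 1%N.
- have cA : #|` A| = 0%N by case: #|` A| A0.
  by have := num_cubes_le k A; rewrite cA exp0n// leqn0 => /eqP->; rewrite powR_ge0.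
- have p0 : 0 < (num_cubes k A)%:R :> R.
    by rewrite ltr0n; apply: leq_trans (num_cubes_ge k A); exact: ltnW.
  have lnA : 0 < ln (#|` A|%:R : R) by rewrite ln_gt0 ?ltr1n.
  have a0 : 0 < #|` A|%:R :> R by rewrite ltr0n ltnW.
  rewrite -ler_ln ?posrE ?powR_gt0// ln_powR -ler_pdivrMr//.
  apply: lb_le_inf => // s [_ /(_ d A d0 gA)].
  by rewrite -ler_ln ?posrE ?powR_gt0// ln_powR ler_pdivrMr.
- rewrite A1 powR1 /=; have := num_cubes_le k A; rewrite A1 exp1n.
  by rewrite -(ler_nat R).
Qed.

(* Main.v *)
Require Import Defs.
From mathcomp Require Import all_boot all_order all_fingroup all_algebra.
From mathcomp Require Import finmap.
From mathcomp Require Import all_classical all_reals all_analysis.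
From mathcomp Require Import fintype finset.
From mathcomp Require Import zify ring lra.
Set Implicit Arguments.
Unset Strict Implicit.
Unset Printing Implicit Defensive.
Import Order.TTheory GRing.Theory Num.Theory.
Import numFieldNormedType.Exports.
Local Open Scope ring_scope.

(** Write [N = n - 1] and let [H m] be the entropy of the binomial distribution of
parameters [m] and 1/2, measured in nats.

The upper bound for the exponent reduces to dimension one.  The Gowers-Cauchy-Schwarz
inequality ([gowers_CauchySchwarz]) and an induction on the dimension, which slices sets
along the first coordinate ([tensorization]), show that an exponent [t >= 2] is admissible
as soon as every probability vector [y] on [{0, ..., N}] satisfies
[[
  \sum_c \prod_S y (c S) `^ (t / 2 ^+ k) <= 1,
]]
where [c] runs over the one-dimensional cubes with vertices [c S] in [{0, ..., N}].  A cube
with [m] nonzero edges contributes at most [expR (- (t * H m))].  This is Gibbs' inequality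
combined with an entropy form of the Littlewood-Offord principle: the vertices of such a
cube are subset sums of [m] nonzero numbers, and their law has entropy at least [H m].  The
reason is that the subsets with a given sum of positive weights form an antichain, to which
the Lubell-Yamamoto-Meshalkin inequality applies ([LYM_subset_sums], [cube_entropy]).

There are [O(k ^ m)] cubes with [m] nonzero edges and none with [m > N]; for [m = N] every
nonzero edge is 1 or -1 and there are at most ['C(k, N) * 2 ^ N] of them, which is at most
[(2 k) ^ N / N!].  With [t = (N ln (2 k) - ln N!) / H N + eps] the class [m = N] thus
contributes at most [expR (- (eps * H N))], while the classes with [0 < m < N] are negligible
because [H m / m] decreases strictly in [m] ([entropy_rate_lt]).  The constant cubes are
harmless when no coordinate of [y] is close to 1; when one is, all cubes but one constant
cube have at least half of their vertices at points of small mass ([concentrated_bound]).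

For the lower bound, take the cubes with exactly [N] nonzero edges, all 1 or -1, that fill
[{0, ..., N}], and let [K = 'C(k, N) * 2 ^ N] be their number.  Use each of them on exactly
[L] of [L * K] coordinates: in the resulting high-dimensional cube every vertex has binomial
type.  There are about [K ^ (L * K)] such cubes and only [expR (L * K * H N)] vectors of
binomial type, so that [ln K <= t * H N] for every admissible [t] ([entropy_lower]).
Finally [ln K] is [N ln (2 k) - ln N! + o(1)]. *)

(** * Gowers norms of functions on an interval *)

(** The vertices of a [k]-dimensional cube are indexed by subsets of ['I_k], the
    set [S] standing for the point [a + \sum_(i in S) h i]. *)
Local Notation labelling k n := {ffun {set 'I_k} -> 'I_n}.

(** Lagrange's identity: the difference of the two sides is half the sum of the squares
    [(u i * v j - u j * v i) ^+ 2]. *)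
Lemma sum_CauchySchwarz (R : realDomainType) (I : finType) (u v : I -> R) :
  (\sum_i u i * v i) ^+ 2 <= (\sum_i u i ^+ 2) * (\sum_i v i ^+ 2).
Proof.
have ge0 : 0 <= \sum_i \sum_j (u i * v j - u j * v i) ^+ 2.
  by apply: sumr_ge0 => i _; apply: sumr_ge0 => j _; exact: sqr_ge0.
suff E : \sum_i \sum_j (u i * v j - u j * v i) ^+ 2 =
   (\sum_i u i ^+ 2) * (\sum_i v i ^+ 2) *+ 2 - (\sum_i u i * v i) ^+ 2 *+ 2.
  by move: ge0; rewrite E subr_ge0 lerMn2r.
transitivity (\sum_i \sum_j (u i ^+ 2 * v j ^+ 2 + v i ^+ 2 * u j ^+ 2
    - (u i * v i) * (u j * v j) *+ 2)).
  by apply: eq_bigr => i _; apply: eq_bigr => j _; ring.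
have D (f g : I -> R) : (\sum_i f i) * (\sum_i g i) = \sum_i \sum_j f i * g j.
  by rewrite big_distrl; apply: eq_bigr => i _; rewrite big_distrr.
set A := \sum_i u i ^+ 2; set B := \sum_i v i ^+ 2; set C := \sum_i u i * v i.
rewrite (_ : A * B *+ 2 - C ^+ 2 *+ 2 = A * B + B * A - C * C *+ 2); last by ring.
rewrite !D -big_split -sumrMnl -sumrB; apply: eq_bigr => i _ /=.
rewrite -big_split -sumrMnl -sumrB.
by apply: eq_bigr.
Qed.

Lemma setU1_id (T : finType) (i : T) (S : {set T}) : i \in S -> i |: S = S.
Proof. by move=> iS; apply/setUidPr; rewrite sub1set. Qed.

Lemma setD1_id (T : finType) (i : T) (S : {set T}) : i \notin S -> S :\ i = S.
Proof. by move=> iS; apply/setDidPl; rewrite disjoint_sym disjoints1. Qed.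

Lemma card_sets k : #|{set 'I_k}| = (2 ^ k)%N.
Proof. by rewrite -cardsT -powersetT card_powerset cardsT card_ord. Qed.

Definition toggle (T : finType) (i : T) (S : {set T}) : {set T} :=
  if i \in S then S :\ i else i |: S.

Lemma toggleK (T : finType) (i : T) : involutive (toggle i).
Proof.
move=> S; rewrite /toggle; case: (boolP (i \in S)) => iS.
  by rewrite setD11 setD1K.
by rewrite setU11 setU1K.
Qed.

Section Gowers.
Variables (R : realDomainType) (k n : nat).
Implicit Types (c x y : labelling k n) (S U J : {set 'I_k}).
Implicit Types (F : {set 'I_k} -> 'I_n -> R).

Definition edge c (i : 'I_k) : int := (c [set i])%:Z - (c set0)%:Z.

(** Cubes are encoded by their vertices rather than by a base point and edges, so that they
    form a finite type and two parallel faces can be glued by a case distinction on [S]. *)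
Definition is_cube c : bool :=
  [forall S : {set 'I_k}, (c S)%:Z == (c set0)%:Z + \sum_(i in S) edge c i].

Lemma is_cubeP c S : is_cube c -> (c S)%:Z = (c set0)%:Z + \sum_(i in S) edge c i.
Proof. by move=> /forallP /(_ S) /eqP. Qed.

Lemma cube_intro c (a : int) (h : 'I_k -> int) :
  (forall S, (c S)%:Z = a + \sum_(i in S) h i) -> is_cube c /\ edge c =1 h.
Proof.
move=> cE; have c0 : (c set0)%:Z = a by rewrite cE big_set0 addr0.
have eE i : edge c i = h i by rewrite /edge c0 cE big_set1; ring.
split=> //; apply/forallP => S; rewrite c0 cE; apply/eqP; congr (_ + _).
exact: eq_bigr.
Qed.

Lemma cube_eq c c' : is_cube c -> is_cube c' -> c set0 = c' set0 ->
  edge c =1 edge c' -> c = c'.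
Proof.
move=> cc cc' e0 eh; apply/ffunP => S; apply/val_inj/eqP.
rewrite -eqz_nat (is_cubeP S cc) (is_cubeP S cc') e0; apply/eqP.
by congr (_ + _); apply: eq_bigr.
Qed.

(** The Gowers inner product of the functions [F S] on an interval. *)
Definition gowers F : R := \sum_(c | is_cube c) \prod_S F S (c S).

Lemma gowers_ge0 F : (forall S v, 0 <= F S v) -> 0 <= gowers F.
Proof. by move=> F0; apply: sumr_ge0 => c _; apply: prodr_ge0. Qed.

Lemma eq_gowers F F' : (forall S v, F S v = F' S v) -> gowers F = gowers F'.
Proof. by move=> E; apply: eq_bigr => c _; apply: eq_bigr. Qed.

Section Step.
Variable i : 'I_k.

Definition face0 c : labelling k n := [ffun S : {set 'I_k} => c (S :\ i)].
Definition face1 c : labelling k n := [ffun S : {set 'I_k} => c (i |: S)].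
Definition glue x y : labelling k n := [ffun S : {set 'I_k} => if i \in S then y S else x S].

(** A face in direction [i] is viewed as a cube whose [i]-th edge is zero. *)
Definition flat x : bool := is_cube x && (edge x i == 0).
Definition parallel x y : bool := [forall j, edge x j == edge y j].

Lemma face0_edge c : is_cube c -> is_cube (face0 c) /\
  edge (face0 c) =1 (fun j => if j == i then 0 else edge c j).
Proof.
move=> cc; apply: (@cube_intro _ (c set0)%:Z) => S; rewrite ffunE (is_cubeP (S :\ i))//;
  congr (_ + _).
rewrite [RHS]big_mkcond [LHS]big_mkcond; apply: eq_bigr => j _; rewrite !inE.
by case: eqP; case: (j \in S).
Qed.

Lemma face1_edge c : is_cube c -> is_cube (face1 c) /\
  edge (face1 c) =1 (fun j => if j == i then 0 else edge c j).
Proof.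
move=> cc; apply: (@cube_intro _ (c [set i])%:Z) => S;
  rewrite ffunE (is_cubeP (i |: S) cc) (is_cubeP [set i] cc).
rewrite big_set1 -addrA (bigD1 i) ?setU11//=; congr (_ + (_ + _)).
rewrite [RHS]big_mkcond [LHS]big_mkcond; apply: eq_bigr => j _; rewrite !inE.
by case: eqP; case: (j \in S).
Qed.

Lemma glue_cube x y : flat x -> flat y -> parallel x y -> is_cube (glue x y).
Proof.
move=> /andP[cx /eqP xi] /andP[cy /eqP yi] /forallP p.
pose h j := if j == i then (y set0)%:Z - (x set0)%:Z else edge x j.
suff /cube_intro[] : forall S, (glue x y S)%:Z = (x set0)%:Z + \sum_(j in S) h j by [].
move=> S; rewrite ffunE; case: ifPn => iS; rewrite (is_cubeP S)//.
  rewrite !(bigD1 i iS)/= {1}/h eqxx yi add0r addrA.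
  rewrite [_ + (_ - _)]addrC subrK; congr (_ + _).
  by apply: eq_bigr => j /andP[_ /negbTE ji]; rewrite /h ji (eqP (p j)).
congr (_ + _); apply: eq_bigr => j jS; rewrite /h; case: eqP => // ji.
by rewrite -ji jS in iS.
Qed.

Lemma flat_del x S : flat x -> x (S :\ i) = x S.
Proof.
move=> /andP[cx /eqP xi]; apply/val_inj/eqP;
  rewrite -eqz_nat (is_cubeP (S :\ i) cx) (is_cubeP S cx).
apply/eqP; congr (_ + _); rewrite [RHS]big_mkcond [LHS]big_mkcond.
by apply: eq_bigr => j _; rewrite !inE; case: eqP => //= ->; case: ifP.
Qed.

Lemma flat_add x S : flat x -> x (i |: S) = x S.
Proof. by move=> fx; rewrite -[RHS]flat_del// -flat_del// setDUl setDv set0U. Qed.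

(** A cube is the same thing as a pair of parallel faces in direction [i]: the missing edge
    is the difference of their base points. *)
Lemma sum_faces (G : labelling k n -> labelling k n -> R) :
  \sum_(c | is_cube c) G (face0 c) (face1 c) =
  \sum_(x | flat x) \sum_(y | flat y && parallel x y) G x y.
Proof.
rewrite pair_big_dep /=.
rewrite [RHS](reindex_onto (fun c => (face0 c, face1 c)) (fun p => glue p.1 p.2)) /=.
  apply: eq_bigl => c; apply/idP/idP => [cc|].
    have [c0 e0] := face0_edge cc; have [c1 e1] := face1_edge cc.
    rewrite /flat c0 c1 e0 e1 eqxx /=; apply/andP; split.
      by apply/forallP => j; rewrite e0 e1.
    apply/eqP/ffunP => S; rewrite !ffunE; case: ifPn => iS; first by rewrite setU1_id.
    by rewrite setD1_id.
  by move=> /andP[/and3P[f0 f1 p] /eqP <-]; exact: glue_cube.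
move=> [x y] /= /and3P[fx fy p]; congr pair; apply/ffunP => S; rewrite !ffunE !inE eqxx /=.
  by rewrite flat_del.
by rewrite flat_add.
Qed.

Lemma prod_faces (F : {set 'I_k} -> 'I_n -> R) c :
  \prod_S F S (c S) =
  (\prod_(S : {set 'I_k} | i \notin S) F S (face0 c S)) *
  (\prod_(S : {set 'I_k} | i \notin S) F (i |: S) (face1 c S)).
Proof.
rewrite (bigID (fun S : {set 'I_k} => i \notin S)) /=; congr (_ * _).
  by apply: eq_bigr => S iS; rewrite ffunE setD1_id.
rewrite (reindex_onto (fun S : {set 'I_k} => i |: S) (fun S : {set 'I_k} => S :\ i)) /=.
  apply: eq_big => [S|S _]; last by rewrite ffunE.
  by rewrite setU11 /=; apply/eqP/idP => [<-|iS]; rewrite ?setD11 // setU1K.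
by move=> S /negPn iS; rewrite setD1K.
Qed.

(** Being parallel is an equivalence relation, so both sides are sums over its classes. *)
Lemma sum_parallel (u v : labelling k n -> R) :
  (\sum_(x | flat x) \sum_(y | flat y && parallel x y) u x * v y) ^+ 2 <=
  (\sum_(x | flat x) \sum_(y | flat y && parallel x y) u x * u y) *
  (\sum_(x | flat x) \sum_(y | flat y && parallel x y) v x * v y).
Proof.
pose cls x := [set y | parallel x y].
have clsP x y : parallel x y = (cls x == cls y).
  apply/idP/eqP => [/forallP p|/setP /(_ y)].
    by apply/setP => z; rewrite !inE; apply: eq_forallb => j; rewrite (eqP (p j)).
  by rewrite !inE => ->; apply/forallP.
have E (f g : labelling k n -> R) :
    \sum_(x | flat x) \sum_(y | flat y && parallel x y) f x * g y =
    \sum_z (\sum_(x | flat x && (cls x == z)) f x) *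
            (\sum_(x | flat x && (cls x == z)) g x).
  rewrite (partition_big cls predT)//=; apply: eq_bigr => z _.
  rewrite big_distrl; apply: eq_bigr => x /andP[_ /eqP <-].
  rewrite big_distrr; apply: eq_bigl => y.
  by rewrite clsP eq_sym.
rewrite !E; exact: sum_CauchySchwarz.
Qed.

(** In terms of the pair of faces the summand is a product of a function of the lower face
    and a function of the upper one. *)
Lemma gowers_step (F : {set 'I_k} -> 'I_n -> R) :
  gowers F ^+ 2 <=
  gowers (fun S => F (S :\ i)) * gowers (fun S => F (i |: S)).
Proof.
pose u x := \prod_(S : {set 'I_k} | i \notin S) F S (x S).
pose v x := \prod_(S : {set 'I_k} | i \notin S) F (i |: S) (x S).
have E G (p q : labelling k n -> R) :
    (forall x, \prod_(S : {set 'I_k} | i \notin S) G S (x S) = p x) ->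
    (forall x, \prod_(S : {set 'I_k} | i \notin S) G (i |: S) (x S) = q x) ->
    gowers G = \sum_(x | flat x) \sum_(y | flat y && parallel x y) p x * q y.
  move=> Ep Eq; rewrite -(sum_faces (fun x y => p x * q y)).
  by apply: eq_bigr => c _; rewrite prod_faces Ep Eq.
rewrite (E F u v)// (E _ u u) ?(E _ v v); first exact: sum_parallel.
all: move=> x; apply: eq_bigr => S iS //.
- by rewrite setUA setUid.
- by rewrite setD1_id.
- by rewrite setU1K.
Qed.
End Step.

(** [gowers_step] is used once for each direction.  After the directions in [J] have been
    treated, the function at the vertex [S] is [F] at the set that agrees with [U] on [J] and
    with [S] outside [J], and the bound is the product over all [U].  It depends on [U] only
    through [U :&: J], which lets each step pair [U] with [toggle i U]. *)
Lemma gowers_CauchySchwarz F : (forall S v, 0 <= F S v) ->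
  gowers F ^+ (2 ^ k) <= \prod_U gowers (fun=> F U).
Proof.
move=> F0; pose G J U := gowers (fun S => F ((S :\: J) :|: (U :&: J))).
have G0 J U : 0 <= G J U by exact: gowers_ge0.
suff H J : gowers F ^+ (2 ^ k) <= \prod_U G J U.
  apply: le_trans (H setT) _; rewrite le_eqVlt; apply/orP; left; apply/eqP.
  by apply: eq_bigr => U _; apply: eq_gowers => S v; rewrite setDT set0U setIT.
suff : forall s : seq 'I_k, gowers F ^+ (2 ^ k) <= \prod_U G [set j in s] U.
  by move/(_ (enum J)); rewrite set_enum.
elim=> [|i s IH].
  rewrite le_eqVlt; apply/orP; left; apply/eqP.
  rewrite (eq_bigr (fun=> gowers F)) ?prodr_const.
    by rewrite -(card_sets k).
  move=> U _; apply: eq_gowers => S v.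
  by rewrite set_nil setD0 setI0 setU0.
apply: le_trans IH _; rewrite set_cons; set K := [set j in s].
have [iK|iK] := boolP (i \in K); first by rewrite setU1_id.
have iNs : (i \in s) = false by move: iK; rewrite inE => /negbTE.
have Pi0 J' : 0 <= \prod_U G J' U by apply: prodr_ge0.
rewrite -ler_sqr ?nnegrE// [leRHS]expr2.
rewrite [X in _ <= _ * X](reindex_inj (inv_inj (toggleK i)))/= -big_split -prodrXl.
apply: ler_prod => U _; rewrite sqr_ge0 /=.
apply: le_trans (gowers_step i _) _; rewrite le_eqVlt; apply/orP; left; apply/eqP.
have EK V : gowers (fun S => F (((S :\ i) :\: K) :|: (V :&: K))) = G (i |: K) (V :\ i).
  apply: eq_gowers => S v; congr (F _ v); apply/setP => j; rewrite !inE.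
  by case: (eqVneq j i) => [->|_]; rewrite ?iNs //= ?andbF ?andbT.
have EK' V : gowers (fun S => F (((i |: S) :\: K) :|: (V :&: K))) = G (i |: K) (i |: V).
  apply: eq_gowers => S v; congr (F _ v); apply/setP => j; rewrite !inE.
  by case: (eqVneq j i) => [->|_]; rewrite ?iNs //= ?andbF ?andbT.
rewrite EK EK' /toggle; case: ifPn => iU.
  by rewrite (setU1_id iU) mulrC.
by rewrite (setD1_id iU).
Qed.
End Gowers.

(** * Passing to higher dimensions *)

Section Slices.
Variable T : finType.

Definition fcons d (x : T) (f : {ffun 'I_d -> T}) : {ffun 'I_d.+1 -> T} :=
  [ffun i => if unlift ord0 i is Some j then f j else x].

Definition slice d (x : T) (S : {set {ffun 'I_d.+1 -> T}}) : {set {ffun 'I_d -> T}} :=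
  [set f | fcons x f \in S].

Lemma card_slices d (S : {set {ffun 'I_d.+1 -> T}}) :
  #|S| = (\sum_x #|slice x S|)%N.
Proof.
pose tl (f : {ffun 'I_d.+1 -> T}) := [ffun j => f (lift ord0 j)].
transitivity (\sum_(f in S) 1)%N; first by rewrite sum1_card.
rewrite (partition_big (fun f : {ffun 'I_d.+1 -> T} => f ord0) predT)//=; apply: eq_bigr => x _.
rewrite -sum1_card (reindex_onto (fcons x) tl) => [|f /andP[_ /eqP fx]].
  apply: eq_bigl => f; rewrite inE; case: (fcons x f \in S) => //=.
  rewrite ffunE unlift_none eqxx /=; apply/eqP/ffunP => j.
  by rewrite !ffunE liftK.
apply/ffunP => i; rewrite !ffunE; case: unliftP => [j ->|->]//.
by rewrite ffunE.
Qed.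
End Slices.

Section Tensor.
Variables (R : realType) (Q B X : finType) (P : pred Q) (v : Q -> B -> X) (s : R).
Hypothesis local : forall g : B -> X -> R, (forall b x, 0 <= g b x) ->
  \sum_(q | P q) \prod_b g b (v q b) `^ s <= \prod_b (\sum_x g b x) `^ s.

Definition lifts d (A : B -> {set {ffun 'I_d -> X}}) : {set {ffun 'I_d -> Q}} :=
  [set C : {ffun 'I_d -> Q} | [forall i, P (C i)] && [forall b, [ffun i => v (C i) b] \in A b]].

(** Fix the first coordinate [q] of a lift: the remaining coordinates form a lift for the
    slices of the [A b] at [v q b].  The induction hypothesis bounds their number by the
    product of the slice sizes to the power [s], and [local] applied to the slice sizes sums
    these bounds over [q].  The sets [A b] must be allowed to differ, since their slices do. *)
Lemma tensorization d (A : B -> {set {ffun 'I_d -> X}}) :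
  #|lifts A|%:R <= \prod_b #|A b|%:R `^ s.
Proof.
elim: d A => [|d IH] A.
  have [->|[C]] := set_0Vmem (lifts A); first by rewrite cards0 prodr_ge0// => b _;
    exact: powR_ge0.
  rewrite inE => /andP[_ /forallP AC].
  rewrite big1 => [|b _].
    rewrite -[leRHS]/(1%:R) ler_nat (leq_trans (max_card _))//.
    by rewrite card_ffun card_ord expn0.
  suff -> : #|A b| = 1%N by rewrite powR1.
  apply/eqP; rewrite eqn_leq card_gt0 (leq_trans (max_card _)) ?card_ffun ?card_ord//=.
  by apply/set0Pn; eexists; exact: AC.
rewrite card_slices natr_sum.
rewrite [leRHS](eq_bigr (fun b => (\sum_x #|slice x (A b)|%:R) `^ s)); last first.
  by move=> b _; rewrite card_slices natr_sum.
apply: le_trans (local _); last by [].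
rewrite [leRHS]big_mkcond; apply: ler_sum => q _.
case: ifP => Pq.
  rewrite (_ : slice q (lifts A) = lifts (fun b => slice (v q b) (A b))); first exact: IH.
  have eqv (C : {ffun 'I_d -> Q}) b : [ffun i => v (fcons q C i) b] = fcons (v q b) [ffun i =>
    v (C i) b].
    by apply/ffunP => i; rewrite !ffunE; case: unliftP => // j _; rewrite ffunE.
  apply/setP => C; rewrite !inE; congr (_ && _).
    apply/forallP/forallP => h i; first by have := h (lift ord0 i); rewrite ffunE liftK.
    by rewrite ffunE; case: unliftP.
  by apply: eq_forallb => b; rewrite eqv inE.
rewrite (_ : slice q _ = set0) ?cards0//; apply/setP => C; rewrite !inE.
by apply/negP => /andP[/forallP /(_ ord0)]; rewrite ffunE unlift_none Pq.
Qed.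
End Tensor.

(** * An inequality of Lubell, Yamamoto and Meshalkin for subset sums *)

(** Each [A \subset E] is [S :&: E] for exactly [2 ^ #|~: E|] sets [S]. *)
Lemma sum_powersetI (V : nmodType) (T : finType) (E : {set T}) (g : {set T} -> V) :
  \sum_(S : {set T}) g (S :&: E) = (\sum_(A in powerset E) g A) *+ 2 ^ #|~: E|.
Proof.
rewrite (partition_big (fun S => S :&: E) (mem (powerset E))) /=; last first.
  by move=> S _; rewrite powersetE subsetIr.
rewrite -sumrMnl; apply: eq_bigr => A; rewrite powersetE => AE.
rewrite (eq_bigr (fun=> g A)); last by move=> S /eqP ->.
rewrite sumr_const; congr (_ *+ _).
rewrite -card_powerset -[RHS](@card_in_imset _ _ (fun B => A :|: B)); last first.
  move=> B1 B2; rewrite !powersetE => /subsetP s1 /subsetP s2 /setP e.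
  apply/setP => i; have := e i; have := s1 i; have := s2 i; rewrite !inE.
  have := subsetP AE i.
  by case: (i \in A) => // [/(_ isT) ->]; case: (i \in B1); case: (i \in B2) => //= h1 h2;
    (by move: (h1 isT)) || by move: (h2 isT).
apply: eq_card => S; rewrite -[LHS]/(S :&: E == A); apply/eqP/imsetP => [<-|[B]].
  exists (S :\: E); last by rewrite setUC; apply/setP => i; rewrite !inE; case: (i \in E);
    case: (i \in S).
  by rewrite powersetE; apply/subsetP => i; rewrite !inE => /andP[].
rewrite powersetE => /subsetP BE ->; apply/setP => i; rewrite !inE.
have := BE i; rewrite inE; have := subsetP AE i.
by case: (i \in A); case: (i \in B); case: (i \in E) => //= h1 h2;
  (by move: (h1 isT)) || by move: (h2 isT).
Qed.

(** The subsets with a given sum form an antichain.  The induction removes one element of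
    [E]: unless the sum is that of [E], every set [A] counted is a proper subset of [E], and
    [1 / 'C(m + 1, #|A|)] is the average over [i] in [E], with value 0 when [i \in A], of
    [1 / 'C(m, #|A|)]. *)
Lemma LYM_subset_sums (F : realFieldType) (T : finType) (w : T -> nat) (E : {set T}) (s : nat) :
  (forall i, i \in E -> (0 < w i)%N) ->
  \sum_(A in powerset E | (\sum_(i in A) w i == s)%N) ('C(#|E|, #|A|)%:R)^-1 <= 1 :> F.
Proof.
move: {2}#|E| (erefl #|E|) => m; elim: m E => [|m IH] E mE w0.
  have E0 : E = set0 by apply/eqP; rewrite -cards_eq0 mE.
  rewrite E0 powerset0 big_mkcondr /= big_set1 big_set0 cards0 bin0 invr1.
  by case: eqP.
have [<-|sE] := eqVneq (\sum_(i in E) w i)%N s.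
  rewrite (big_pred1 E) ?binn ?invr1// => A /=; rewrite powersetE.
  apply/andP/eqP => [[AE /eqP e]|->]; last by [].
  apply/eqP; rewrite eqEsubset AE /=; apply/subsetP => i iE.
  apply/negPn/negP => iA; move: e; rewrite [X in _ = X -> _](big_setID A) /=.
  rewrite (setIidPr AE) -[X in X = _ -> _]addn0 => /addnI /eqP.
  rewrite (bigD1 i) ?inE ?iE ?iA //=; have := w0 i iE; lia.
have step (A : {set T}) : A \in powerset E -> ((\sum_(i in A) w i)%N == s) ->
    ('C(#|E|, #|A|)%:R)^-1 = (m.+1%:R)^-1 * \sum_(i in E :\: A) ('C(m, #|A|)%:R)^-1 :> F.
  rewrite powersetE => AE /eqP As; rewrite sumr_const cardsD (setIidPr AE) mE.
  have lA : (#|A| < m.+1)%N.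
    rewrite -mE; apply: proper_card; rewrite properEneq AE andbT.
    by apply: contraNneq sE => <-; apply/eqP.
  have C0 : 'C(m, #|A|)%:R != 0 :> F by rewrite pnatr_eq0 -lt0n bin_gt0.
  have C1 : 'C(m.+1, #|A|)%:R != 0 :> F by rewrite pnatr_eq0 -lt0n bin_gt0 ltnW.
  have m0 : m.+1%:R != 0 :> F by rewrite pnatr_eq0.
  have := mul_bin_down m.+1 #|A| => /(congr1 (fun x => x%:R : F)); rewrite !natrM => e.
  have -> : ('C(m.+1, #|A|)%:R)^-1 = (m.+1%:R * 'C(m, #|A|)%:R)^-1 * (m.+1 - #|A|)%:R :> F.
    by apply: (mulIf C1); rewrite mulVf// -mulrA -e mulVf// mulf_neq0.
  by rewrite -[_^-1 *+ _]mulr_natr mulrA invfM.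
rewrite (eq_bigr (fun A : {set T} => (m.+1%:R)^-1 * \sum_(i in E :\: A) ('C(m, #|A|)%:R)^-1));
  last first.
  by move=> A /andP[]; exact: step.
rewrite -big_distrr /=.
rewrite (exchange_big_dep (fun i => i \in E)) /=; last by move=> A i _; rewrite inE => /andP[].
rewrite ler_pdivrMl ?ltr0n// mulr1 -mE -sum1_card natr_sum; apply: ler_sum => i iE.
have mEi : #|E :\ i| = m by have := cardsD1 i E; rewrite iE mE => -[].
have w0' j : j \in E :\ i -> (0 < w j)%N by rewrite inE => /andP[_]; exact: w0.
apply: le_trans (IH _ mEi w0'); rewrite mEi.
rewrite le_eqVlt; apply/orP; left; apply/eqP; apply: eq_bigl => A.
rewrite !inE iE andbT subsetD1; case: (A \subset E) => //=; case: (i \in A); case: eqP => //=.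
Qed.

(** * Entropy of the vertices of a cube *)

Lemma sum_powerset_card (V : nmodType) (T : finType) (E : {set T}) (g : nat -> V) :
  \sum_(A in powerset E) g #|A| = \sum_(j < #|E|.+1) g j *+ 'C(#|E|, j).
Proof.
rewrite (partition_big (fun A : {set T} => inord #|A| : 'I_#|E|.+1) predT)//=.
apply: eq_bigr => j _; rewrite (eq_bigr (fun=> g j)).
  rewrite sumr_const; congr (_ *+ _); rewrite -cards_draws.
  apply: eq_card => A; rewrite [RHS]inE -[LHS]/((A \in powerset E) && (inord #|A| == j))
    powersetE.
  case: (boolP (A \subset E)) => //= AE.
  by rewrite -(inj_eq val_inj) /= inordK // ltnS subset_leq_card.
move=> A /andP[]; rewrite powersetE => AE /eqP <-.
by rewrite inordK // ltnS subset_leq_card.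
Qed.

(** The entropy, in nats, of the binomial distribution of parameters [m] and 1/2. *)
Definition nat_entropy (R : realType) (m : nat) : R :=
  m%:R * ln 2 - (\sum_(j < m.+1) ln 'C(m, j)%:R *+ 'C(m, j)) / 2 ^+ m.
Arguments nat_entropy R m : clear implicits.

Lemma ln_le_subr1 (R : realType) (u : R) : 0 < u -> ln u <= u - 1.
Proof. by move=> u0; rewrite -{1}[u](subrKC 1) le_ln1Dx// ltrBrDr addNr. Qed.

(** Gibbs' inequality compares [y \o f] with the uniform law on [O].  The numbers
    [y (f o) / w o] define a sub-probability on [O] because of the hypothesis on the fibres
    of [f], which is the form in which an inequality of LYM type is available. *)
Lemma Gibbs (R : realType) (O X : finType) (f : O -> X) (w : O -> R) (y : X -> R) :
  (forall o, 0 < w o) -> (forall x, \sum_(o | f o == x) (w o)^-1 <= 1) ->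
  (forall x, 0 <= y x) -> \sum_x y x <= 1 -> (forall o, 0 < y (f o)) ->
  \sum_o ln (y (f o)) <= \sum_o ln (w o / #|O|%:R).
Proof.
move=> w0 w1 y0 y1 yf0; rewrite -subr_le0 -sumrB.
have O0 (o : O) : 0 < #|O|%:R :> R by rewrite ltr0n; apply/card_gt0P; exists o.
apply: (@le_trans _ _ (\sum_o (y (f o) * #|O|%:R * (w o)^-1 - 1))).
  apply: ler_sum => o _; rewrite -ln_div ?posrE ?divr_gt0//; last exact: O0.
  rewrite invf_div mulrA; apply: ln_le_subr1.
  by rewrite divr_gt0// mulr_gt0// (O0 o).
rewrite sumrB sumr_const subr_le0.
rewrite (partition_big f predT)//=.
apply: (@le_trans _ _ (\sum_x y x * #|O|%:R)); last first.
  by rewrite -big_distrl /= -[leRHS]mul1r ler_wpM2r.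
apply: ler_sum => x _.
rewrite (eq_bigr (fun o => y x * #|O|%:R * (w o)^-1)); last by move=> o /eqP ->.
by rewrite -big_distrr /= -[leRHS]mulr1 ler_wpM2l// mulr_ge0.
Qed.

Section CubeEntropy.
Variables (R : realType) (k n : nat) (c : labelling k n).
Hypothesis cc : is_cube c.

Definition supp : {set 'I_k} := [set i | edge c i != 0].
(** Exchanging the two ends of every negative edge replaces [edge c i] by its absolute
    value. *)
Definition flip (S : {set 'I_k}) : {set 'I_k} := [set i | (i \in S) (+) (edge c i < 0)].

Lemma flipK : involutive flip.
Proof. by move=> S; apply/setP => i; rewrite !inE addbK. Qed.

Lemma cube_flip S : (c (flip S))%:Z = (c (flip set0))%:Z + (\sum_(i in S) absz (edge c i))%:Z.
Proof.
rewrite (is_cubeP (flip S) cc) (is_cubeP (flip set0) cc) -addrA; congr (_ + _).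
rewrite (big_morph Posz PoszD (erefl _)).
rewrite [LHS]big_mkcond [X in _ = X + _]big_mkcond [X in _ = _ + X]big_mkcond -big_split;
  apply: eq_bigr => i _; rewrite !inE /=.
by case: (i \in S); case: ltP => /=; lia.
Qed.

Let m := #|supp|.
(* A fibre of [fun S => S :&: supp] has [2 ^ (k - m)] elements. *)
Let weight S : R := 2 ^+ (k - m) * 'C(m, #|flip S :&: supp|)%:R.

Lemma weight_gt0 S : 0 < weight S.
Proof.
rewrite mulr_gt0 ?exprn_gt0// ltr0n bin_gt0.
by rewrite subset_leq_card// subsetIr.
Qed.

Lemma card_suppC : #|~: supp| = (k - m)%N.
Proof. by rewrite cardsCs setCK card_ord. Qed.

Lemma sum_inv_weight_le1 x : \sum_(S | c S == x) (weight S)^-1 <= 1.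
Proof.
rewrite (reindex_inj (inv_inj flipK)) /=.
set s := absz (x%:Z - (c (flip set0))%:Z).
pose g (A : {set 'I_k}) : R := if (\sum_(i in A) absz (edge c i))%N == s then ('C(m,
  #|A|)%:R)^-1 else 0.
apply: (@le_trans _ _ (\sum_(S : {set 'I_k}) (2 ^+ (k - m))^-1 * g (S :&: supp))).
  rewrite big_mkcond; apply: ler_sum => S _.
  have g0 : 0 <= g (S :&: supp) by rewrite /g; case: ifP.
  case: ifPn => [/eqP cS|_]; last by rewrite mulr_ge0// invr_ge0 exprn_ge0.
  rewrite /weight flipK invfM /g ifT // /s -cS cube_flip addrC addKr absz_nat.
  rewrite [X in _ == X](big_setID supp) /= [X in (_ + X)%N]big1 ?addn0//.
  by move=> i; rewrite !inE negbK => /andP[/eqP ->].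
rewrite -big_distrr /= ler_pdivrMl ?exprn_gt0// mulr1.
rewrite (sum_powersetI supp g) card_suppC -[_ *+ (2 ^ _)%N]mulr_natl natrX.
rewrite -[leRHS]mulr1 ler_wpM2l ?exprn_ge0// -big_mkcondr.
by apply: LYM_subset_sums => i; rewrite inE absz_gt0.
Qed.

Lemma sum_ln_weight : \sum_S ln (weight S / #|{set 'I_k}|%:R) = - (2 ^+ k * nat_entropy R m).
Proof.
have mk : (m <= k)%N by rewrite -[X in (_ <= X)%N]card_ord max_card.
have e2k : 2 ^+ k = 2 ^+ (k - m) * 2 ^+ m :> R by rewrite -exprD subnK.
rewrite card_sets natrX (reindex_inj (inv_inj flipK)) /=.
rewrite (eq_bigr (fun S : {set 'I_k} => ln ('C(m, #|S :&: supp|)%:R : R) - m%:R * ln 2));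
  last first.
  move=> S _; rewrite /weight flipK e2k.
  have C0 : 0 < 'C(m, #|S :&: supp|)%:R :> R by rewrite ltr0n bin_gt0 subset_leq_card//
    subsetIr.
  rewrite -mulf_div mulfV ?mul1r ?expf_neq0//.
  by rewrite ln_div ?posrE ?exprn_gt0// lnXn// mulr_natl.
rewrite sumrB sumr_const card_sets.
rewrite (sum_powersetI supp (fun A : {set 'I_k} => ln ('C(m, #|A|)%:R : R))).
rewrite (sum_powerset_card supp (fun j => ln ('C(m, j)%:R : R))) card_suppC -/m.
rewrite /nat_entropy -[_ *+ (2 ^ (k - m))%N]mulr_natl -[_ *+ (2 ^ k)%N]mulr_natl !natrX.
rewrite e2k.
set a := 2 ^+ (k - m); set b := 2 ^+ m.
have b0 : b != 0 by rewrite expf_neq0.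
by field.
Qed.

(** The entropy of the uniform measure on the vertices is at least that of the binomial
    distribution with as many steps as there are nonzero edges. *)
Lemma cube_entropy (y : 'I_n -> R) (t : R) : (forall x, 0 <= y x) -> \sum_x y x <= 1 ->
  0 < t -> \prod_S y (c S) `^ (t / 2 ^+ k) <= expR (- (t * nat_entropy R #|supp|)).
Proof.
move=> y0 y1 t0; have t2 : 0 < t / 2 ^+ k by rewrite divr_gt0// exprn_gt0.
have [/existsP[S /eqP yS]|/existsPn ny] := boolP [exists S, y (c S) == 0].
  by rewrite (bigD1 S)//= yS powR0 ?gt_eqF// mul0r expR_ge0.
have yc S : 0 < y (c S) by rewrite lt_neqAle eq_sym ny y0.
rewrite (eq_bigr (fun S => expR (t / 2 ^+ k * ln (y (c S))))); last first.
  by move=> S _; rewrite /powR gt_eqF.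
rewrite -expR_sum ler_expR -big_distrr /=.
have := Gibbs weight_gt0 sum_inv_weight_le1 y0 y1 yc; rewrite sum_ln_weight => h.
apply: le_trans (ler_wpM2l (ltW t2) h) _; rewrite le_eqVlt; apply/orP; left; apply/eqP.
rewrite -/m; set b := 2 ^+ k; have b0 : b != 0 by rewrite expf_neq0.
by field.
Qed.
End CubeEntropy.

(** * Entropy of the binomial distribution *)

Lemma sum_bin m : (\sum_(j < m.+1) 'C(m, j))%N = (2 ^ m)%N.
Proof.
rewrite -[2%N]/(1 + 1)%N Pascal; apply: eq_bigr => j _.
by rewrite !exp1n !muln1.
Qed.

(** One term of the binomial expansion of [((N - i) + i) ^ N] is less than the whole sum. *)
Lemma bin_lt_entropy N i : (0 < i < N)%N ->
  ('C(N, i) * ((N - i) ^ (N - i) * i ^ i) < N ^ N)%N.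
Proof.
move=> /andP[i0 iN]; rewrite -{4}(subnK (ltnW iN)) Pascal.
have iN1 : (i < N.+1)%N by apply: ltnW.
rewrite (bigD1 (Ordinal iN1))//= (bigD1 ord0) /=;
  last by rewrite -(inj_eq val_inj) /= eq_sym -lt0n.
rewrite -[X in (X < _)%N]addn0 ltn_add2l bin0 mul1n expn0 muln1 subn0.
by rewrite ltn_addr// expn_gt0 subn_gt0 iN.
Qed.

Section EntropyMonotone.
Variable R : realType.
Local Notation Hn := (nat_entropy R).
Local Notation F m := (\sum_(j < m.+1) ln 'C(m, j)%:R *+ 'C(m, j) : R).

Lemma nat_entropy_gt0 m : (0 < m)%N -> 0 < Hn m.
Proof.
move=> m0; have l2 : 0 < ln 2 :> R by rewrite ln_gt0 ?ltr1n.
have E : Hn m * 2 ^+ m = \sum_(j < m.+1) (m%:R * ln 2 - ln 'C(m, j)%:R) *+ 'C(m, j).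
  rewrite /nat_entropy mulrBl divfK ?expf_neq0// -natrX -sum_bin natr_sum.
  rewrite big_distrr -sumrB; apply: eq_bigr => j _ /=.
  by rewrite mulrnBl mulr_natr.
have p2 : 0 < 2 ^+ m :> R by rewrite exprn_gt0.
rewrite -(pmulr_lgt0 _ p2) E (bigD1 ord0)//= bin0 ln1 subr0 mulr1n.
rewrite ltr_pwDl ?mulr_gt0 ?ltr0n// sumr_ge0// => j _.
have jm : (j <= m)%N by rewrite -ltnS.
rewrite mulrn_wge0// subr_ge0 mulr_natl -lnXn// ler_ln ?posrE ?exprn_gt0 ?ltr0n ?bin_gt0//.
rewrite -natrX ler_nat -sum_bin (bigD1 j)//= leq_addr //.
Qed.

(** Both ['C(m, i)] and ['C(m, i.-1)] are fractions of ['C(m.+1, i)], namely [(m + 1 - i) /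
    (m + 1)] and [i / (m + 1)], so this is the logarithm of [bin_lt_entropy]. *)
Lemma ln_bin_step m i : (0 < i <= m)%N ->
  (m.+1 - i)%:R * ln 'C(m, i)%:R + i%:R * ln 'C(m, i.-1)%:R < m%:R * ln 'C(m.+1, i)%:R :> R.
Proof.
move=> /andP[i0 im]; have iN : (0 < i < m.+1)%N by rewrite i0.
have e1 : (m.+1 * 'C(m, i) = (m.+1 - i) * 'C(m.+1, i))%N by rewrite -mul_bin_down.
have e2 : (m.+1 * 'C(m, i.-1) = i * 'C(m.+1, i))%N by rewrite -{2 3}(prednK i0) -mul_bin_diag.
have C0 : 0 < 'C(m.+1, i)%:R :> R by rewrite ltr0n bin_gt0 ltnW.
have C1 : 0 < 'C(m, i)%:R :> R by rewrite ltr0n bin_gt0.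
have C2 : 0 < 'C(m, i.-1)%:R :> R by rewrite ltr0n bin_gt0 (leq_trans (leq_pred _)).
have N0 : 0 < m.+1%:R :> R by rewrite ltr0n.
have I0 : 0 < i%:R :> R by rewrite ltr0n.
have J0 : 0 < (m.+1 - i)%:R :> R by rewrite ltr0n subn_gt0.
have l1 : ln 'C(m, i)%:R = ln (m.+1 - i)%:R + ln 'C(m.+1, i)%:R - ln m.+1%:R :> R.
  by apply/eqP; rewrite eq_sym subr_eq -!lnM ?posrE// -!natrM -e1 mulnC.
have l2 : ln 'C(m, i.-1)%:R = ln i%:R + ln 'C(m.+1, i)%:R - ln m.+1%:R :> R.
  by apply/eqP; rewrite eq_sym subr_eq -!lnM ?posrE// -!natrM -e2 mulnC.
have := bin_lt_entropy iN; rewrite -(ltr_nat R) !natrM !natrX => ltN.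
rewrite -ltr_ln ?posrE ?mulr_gt0 ?exprn_gt0// in ltN; move: ltN.
rewrite lnM ?posrE ?mulr_gt0 ?exprn_gt0// lnM ?posrE ?exprn_gt0// !lnXn//.
rewrite -![ln _ *+ _]mulr_natl l1 l2.
have -> : m.+1%:R = (m.+1 - i)%:R + i%:R :> R by rewrite -natrD (subnK (ltnW _)).
have -> : m%:R = (m.+1 - i)%:R + i%:R - 1 :> R by rewrite -natrD (subnK (ltnW _))// -natr1
  addrK.
lra.
Qed.

(** By [ln_bin_step] the mean of [ln 'C(m, j)], divided by [m], increases with [m]: the
    identities for [m.+1 * 'C(m, j)] turn the sum for [m] into one with the weights
    ['C(m.+1, i)], and the two sums are then compared term by term. *)
Lemma entropy_rate_step m : (0 < m)%N -> Hn m.+1 / m.+1%:R < Hn m / m%:R.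
Proof.
move=> m0.
have key : 2 * (m.+1%:R * F m) < m%:R * F m.+1.
  have -> : 2 * (m.+1%:R * F m) = \sum_(i < m.+2)
      ((m.+1 - i)%:R * ln 'C(m, i)%:R + i%:R * ln 'C(m, i.-1)%:R) *+ 'C(m.+1, i).
    have -> : 2 * (m.+1%:R * F m) = m.+1%:R * F m + m.+1%:R * F m by ring.
    under [RHS]eq_bigr do rewrite mulrnDl.
    rewrite big_split /=; congr (_ + _).
      rewrite [RHS]big_ord_recr /= subnn mul0r mul0rn addr0 big_distrr;
        apply: eq_bigr => j _ /=.
      by rewrite !mulr_natl -!mulrnA -mul_bin_down mulnC.
    rewrite [RHS]big_ord_recl /= mul0r mul0rn add0r big_distrr; apply: eq_bigr => j _ /=.
    by rewrite !mulr_natl -!mulrnA -mul_bin_diag mulnC.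
  rewrite big_distrr /=.
  have m2 : (1 < m.+2)%N by [].
  rewrite (bigD1 (Ordinal m2))//= [ltRHS](bigD1 (Ordinal m2))//=.
  apply: ltr_leD.
    by rewrite [ltRHS]mulrnAr ltr_pMn2r ?bin_gt0// ln_bin_step.
  apply: ler_sum => i _; rewrite [leRHS]mulrnAr lerMn2r; apply/orP; right;
    case: (posnP i) => [->|i0].
    by rewrite /= !bin0 !ln1 !mulr0 addr0.
  have := ltn_ord i; rewrite ltnS leq_eqVlt => /orP[/eqP ->|im].
    by rewrite subnn !binn ln1 mul0r !mulr0 add0r.
  by apply: ltW; apply: ln_bin_step; rewrite i0 -ltnS.
have M0 : 0 < m%:R :> R by rewrite ltr0n.
have N0 : 0 < m.+1%:R :> R by rewrite ltr0n.
rewrite ltr_pdivrMr// mulrAC ltr_pdivlMr// /nat_entropy exprS.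
set a := F m in key *; set b := F m.+1 in key *; set p := 2 ^+ m.
have p0 : 0 < p by rewrite exprn_gt0.
have : (2 * (m.+1%:R * a)) / (2 * p) < (m%:R * b) / (2 * p) by rewrite ltr_pM2r ?invr_gt0
  ?mulr_gt0.
have -> : (2 * (m.+1%:R * a)) / (2 * p) = m.+1%:R * (a / p) by field; rewrite gt_eqF.
nra.
Qed.

Lemma entropy_rate_lt m N : (0 < m < N)%N -> Hn N / N%:R < Hn m / m%:R.
Proof.
move=> /andP[m0]; elim: N => // N IH; rewrite ltnS leq_eqVlt => /orP[/eqP <-|mN].
  exact: entropy_rate_step.
apply: lt_trans (IH mN); apply: entropy_rate_step; exact: leq_trans mN.
Qed.
End EntropyMonotone.

(** * Counting cubes in an interval *)

Section Counting.
Variables (k N : nat).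
Implicit Types c : labelling k N.+1.

Lemma sum_edges c : is_cube c -> (c (flip c set0) + \sum_i absz (edge c i) <= N)%N.
Proof.
move=> cc; have := cube_flip cc setT; rewrite (eq_bigl predT); last by move=> i; rewrite inE.
by rewrite -PoszD => -[<-]; rewrite -ltnS.
Qed.

Lemma sum_edges_supp c : (\sum_i absz (edge c i) = \sum_(i in supp c) absz (edge c i))%N.
Proof.
rewrite [LHS](bigID (mem (supp c))) /= [X in (_ + X)%N]big1 ?addn0// => i.
by rewrite !inE negbK => /eqP ->.
Qed.

Lemma card_supp_sum c : (#|supp c| <= \sum_i absz (edge c i))%N.
Proof.
rewrite sum_edges_supp -sum1_card; apply: leq_sum => i.
by rewrite inE absz_gt0.
Qed.

Lemma card_supp_le c : is_cube c -> (#|supp c| <= N)%N.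
Proof.
move=> /sum_edges; apply: leq_trans; apply: leq_trans (card_supp_sum c) _.
exact: leq_addl.
Qed.

(** The absolute values of the edges add up to at most [N], so when there are [N] nonzero
    ones nothing is left over. *)
Lemma extremal_cube c : is_cube c -> #|supp c| = N ->
  c (flip c set0) = ord0 /\ forall i, i \in supp c -> absz (edge c i) = 1%N.
Proof.
move=> cc sN; have := sum_edges cc; have := card_supp_sum c; rewrite sN => h1 h2.
have c0 : c (flip c set0) = 0%N :> nat by lia.
split; first exact: val_inj.
have e : (\sum_(i in supp c) (absz (edge c i) - 1) = 0)%N.
  rewrite sumnB; last by move=> i; rewrite inE absz_gt0.
  by rewrite sum1_card sN -sum_edges_supp; lia.
move=> i iS; have := iS; rewrite inE -absz_gt0.
move: e; rewrite (bigD1 i)//=; lia.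
Qed.

(** A pair [(E, F)] stands for the cube of base point [#|F|] whose edges are -1 on [F], 1 on
    [E :\: F] and 0 outside [E]. *)
Definition signed_sets : {set {set 'I_k} * {set 'I_k}} :=
  [set p : {set 'I_k} * {set 'I_k} | (#|p.1| == N) && (p.2 \subset p.1)].

Lemma sum_signed_sets (f : {set 'I_k} -> {set 'I_k} -> nat) :
  (\sum_(p in signed_sets) f p.1 p.2 =
   \sum_(E : {set 'I_k} | #|E| == N) \sum_(F in powerset E) f E F)%N.
Proof.
rewrite pair_big_dep /=; apply: eq_bigl => p.
by rewrite inE powersetE.
Qed.

Lemma card_sets_of_card m : #|[pred E : {set 'I_k} | #|E| == m]| = 'C(k, m).
Proof. by rewrite -[k in RHS]card_ord -card_draws; apply: eq_card => E; rewrite !inE. Qed.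

Lemma card_signed_sets : #|signed_sets| = ('C(k, N) * 2 ^ N)%N.
Proof.
rewrite -sum1_card (sum_signed_sets (fun _ _ => 1%N)).
rewrite (eq_bigr (fun=> (2 ^ N)%N)); last by move=> E /eqP EN;
  rewrite sum1_card card_powerset EN.
by rewrite sum_nat_const card_sets_of_card.
Qed.

Lemma count_extremal_cubes :
  (#|[set c : labelling k N.+1 | is_cube c && (#|supp c| == N)]| <= 'C(k, N) * 2 ^ N)%N.
Proof.
rewrite -card_signed_sets.
pose f (c : labelling k N.+1) := (supp c, flip c set0).
rewrite -(card_in_imset (f := f)); last first.
  move=> c c'; rewrite !inE => /andP[cc /eqP cN] /andP[cc' /eqP cN'] [es ef].
  have [c0 h] := extremal_cube cc cN; have [c0' h'] := extremal_cube cc' cN'.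
  have ee : edge c =1 edge c'.
    move=> i; have := h i; have := h' i; rewrite -es.
    have := congr1 (fun S : {set 'I_k} => i \in S) ef; rewrite !inE /=.
    have := congr1 (fun S : {set 'I_k} => i \in S) es; rewrite !inE.
    case: eqP => [->|_] /=; first by move/esym/negbFE/eqP => ->.
    move=> _ + /(_ isT) + /(_ isT).
    by case: (ltP (edge c i) 0); case: (ltP (edge c' i) 0) => //= ? ? _; lia.
  apply: cube_eq => //; apply/val_inj/eqP; rewrite -eqz_nat; apply/eqP.
  have := is_cubeP (flip c set0) cc; have := is_cubeP (flip c' set0) cc'.
  rewrite c0 c0' ef (eq_bigr (edge c) (fun i _ => esym (ee i))) => e1 e2.
  by apply: (addIr (\sum_(i in flip c' set0) edge c i)); rewrite -e1 -e2.
apply: subset_leq_card; apply/subsetP => p /imsetP[c]; rewrite !inE => /andP[_ sN] -> /=.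
rewrite sN; apply/subsetP => i; rewrite !inE /=; case: ltP => // h _.
by rewrite lt_eqF.
Qed.

(** A cube is determined by its base point [a], its set [E] of nonzero edges, and the
    vertices at the singletons, which are [a] outside [E]. *)
Lemma count_cubes m :
  (#|[set c : labelling k N.+1 | is_cube c && (#|supp c| == m)]| <= N.+1 * ('C(k, m) * N.+1 ^
    m))%N.
Proof.
pose corner (c : labelling k N.+1) : {ffun 'I_k -> 'I_N.+1} := [ffun i => c [set i]].
rewrite -sum1_card.
rewrite (partition_big (fun c => c set0) predT)//=.
rewrite -[X in (_ <= X * _)%N]card_ord -sum_nat_const; apply: leq_sum => a _.
rewrite (partition_big (@supp k N.+1) (fun E : {set 'I_k} => #|E| == m)) /=; last first.
  by move=> c; rewrite inE => /andP[/andP[]].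
rewrite -card_sets_of_card -sum_nat_const; apply: leq_sum => E /eqP Em.
rewrite sum1_card -[X in (_ <= X ^ _)%N]card_ord -{2}Em.
rewrite -(card_pffun_on a (mem E) (mem 'I_N.+1)).
set D := (X in (#|X| <= _)%N).
have DE c : c \in D -> [/\ is_cube c, c set0 = a & supp c = E].
  have -> : c \in D = [&& is_cube c && (#|supp c| == m), c set0 == a & supp c == E].
    rewrite -[LHS]/((c \in [set c : labelling k N.+1 | is_cube c && (#|supp c| == m)]) && (c
      set0 == a) && (supp c == E)).
    by rewrite inE -!andbA.
  by case/and3P => /andP[cc _] /eqP ca /eqP cE.
rewrite -(@card_in_image _ _ corner D); last first.
  move=> c c' /DE[cc ca _] /DE[cc' ca' _] e.
  apply: cube_eq => //; first by rewrite ca ca'.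
  by move=> i; rewrite /edge ca ca'; have := congr1 (fun f : {ffun 'I_k -> 'I_N.+1} => f i) e;
    rewrite !ffunE => ->.
apply: subset_leq_card; apply/subsetP => p /imageP[c /DE[cc ca cE] ->].
apply/pffun_onP; split; last by [].
apply/subsetP => i; rewrite !inE ffunE -cE inE; apply: contraNneq => /eqP.
by rewrite /edge ca subr_eq0 eqz_nat => /eqP/val_inj ->.
Qed.
End Counting.

(** * The inequality in dimension one *)

Section OneDim.
Variables (R : realType) (k N : nat).
Implicit Types c : labelling k N.+1.

(** Moving along a nonzero edge leaves [j], so at most one vertex in two is equal to [j]. *)
Lemma cube_half c (j : 'I_N.+1) : is_cube c -> c != [ffun=> j] ->
  (2 ^ k <= #|[pred S | c S != j]|.*2)%N.
Proof.
move=> cc cj; rewrite -card_sets -addnn -(cardC [pred S | c S != j]) leq_add2l.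
(* Without nonzero edges all vertices coincide, and they differ from [j]. *)
have [s0|[i]] := set_0Vmem (supp c).
  have cst S : c S = c set0.
    apply/val_inj/eqP; rewrite -eqz_nat (is_cubeP S cc) big1 ?addr0// => i _.
    by have := in_set0 i; rewrite -s0 inE => /negbFE/eqP.
  have c0 : c set0 != j.
    by apply: contraNneq cj => e; apply/eqP/ffunP => S; rewrite ffunE cst.
  rewrite (_ : #|_| = 0%N)//; apply: eq_card0 => S; rewrite !inE /= cst.
  by rewrite negbK; apply/negbTE.
rewrite inE => ei.
rewrite -(card_imset _ (inv_inj (toggleK i))); apply: subset_leq_card.
apply/subsetP => _ /imsetP[S + ->]; rewrite !inE negbK => /eqP cS.
apply/negP => /eqP cs.
have e : \sum_(l in S) edge c l = \sum_(l in toggle i S) edge c l.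
  by apply: (addrI (c set0)%:Z); rewrite -!is_cubeP// cS cs.
move: e; rewrite /toggle; case: ifPn => iS.
  rewrite (big_setD1 i)//= => /eqP; rewrite -[eqbRHS]add0r.
  by rewrite (inj_eq (addIr _)) (negbTE ei).
rewrite (big_setU1 i iS)/= => /esym/eqP; rewrite -[eqbRHS]add0r.
by rewrite (inj_eq (addIr _)) (negbTE ei).
Qed.

Variables (t : R) (y : 'I_N.+1 -> R).
Hypotheses (t2 : 2 <= t) (y0 : forall x, 0 <= y x) (y1 : \sum_x y x = 1).
Let s := t / 2 ^+ k.

Let t0 : 0 < t. Proof. by apply: lt_le_trans t2; rewrite ltr0n. Qed.
Let s0 : 0 < s. Proof. by rewrite divr_gt0// exprn_gt0. Qed.

Lemma y_le1 x : y x <= 1.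
Proof. by rewrite -y1 (bigD1 x)//= lerDl sumr_ge0. Qed.

Lemma prod_const (z : R) : \prod_(S : {set 'I_k}) z `^ s = z `^ t.
Proof.
rewrite prodr_const card_sets -powR_mulrn ?powR_ge0// -powRrM natrX.
by rewrite divfK// expf_neq0.
Qed.

Lemma powR_le1 (z p : R) : 0 <= z <= 1 -> 0 <= p -> z `^ p <= 1.
Proof.
move=> /andP[z0 z1] p0; have := @ge0_ler_powR R p p0 z 1.
by rewrite !nnegrE powR1 z0 ler01 => /(_ isT isT z1).
Qed.

Lemma off_const_term c j : is_cube c -> c != [ffun=> j] ->
  \prod_S y (c S) `^ s <= (1 - y j) `^ (t / 2).
Proof.
move=> cc cj; have h0 : 0 <= 1 - y j by rewrite subr_ge0 y_le1.
rewrite (bigID (fun S => c S != j)) /=.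
apply: (@le_trans _ _ (\prod_(S | c S != j) y (c S) `^ s)).
  rewrite ler_piMr ?prodr_ge0// => [S _|]; first exact: powR_ge0.
  by apply: Num.Theory.prodr_ile1 => S _; rewrite powR_ge0 powR_le1 ?y0 ?y_le1// ltW.
apply: (@le_trans _ _ (\prod_(S | c S != j) (1 - y j) `^ s)).
  apply: ler_prod => S cS; rewrite powR_ge0 ge0_ler_powR ?nnegrE ?(ltW s0)//.
  by rewrite lerBrDr -y1 (bigD1 (c S))//= lerD2l (bigD1 j) 1?eq_sym//= lerDl sumr_ge0.
rewrite prodr_const -powR_mulrn ?powR_ge0// -powRrM.
have half := cube_half cc cj.
have p : t / 2 <= s * #|[pred S | c S != j]|%:R.
  rewrite /s mulrAC ler_pdivlMr ?exprn_gt0// mulrAC -mulrA ler_pM2l//.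
  by rewrite ler_pdivrMr ?ltr0n// -natrX -natrM ler_nat muln2.
have [->|h1] := eqVneq (1 - y j) 0.
  by rewrite !powR0// gt_eqF// ?divr_gt0 ?ltr0n// (lt_le_trans _ p)// divr_gt0.
apply: ger_powR => //; rewrite lt_neqAle eq_sym h1 h0 /=.
by rewrite gerBl.
Qed.

(** The constant cube at [j] contributes at most [y j], and the others at most
    [M * eta `^ (t / 2)] with [eta = 1 - y j].  This is at most [eta] since [eta <= delta]. *)
Lemma concentrated_bound (M delta : R) j :
  #|[pred c : labelling k N.+1 | is_cube c]|%:R <= M ->
  0 < delta -> M * delta `^ (t / 2 - 1) <= 1 -> 1 - y j <= delta ->
  \sum_(c : labelling k N.+1 | is_cube c) \prod_S y (c S) `^ s <= 1.
Proof.
move=> hM d0 Md jd; set eta := 1 - y j in jd *.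
have eta0 : 0 <= eta by rewrite subr_ge0 y_le1.
have M0 : 0 <= M by apply: le_trans hM.
have cst : is_cube ([ffun=> j] : labelling k N.+1).
  have [] // := @cube_intro k N.+1 [ffun=> j] j%:Z (fun=> 0).
  by move=> S; rewrite ffunE big1 ?addr0.
rewrite (bigD1 [ffun=> j])//=.
apply: (@le_trans _ _ (y j + M * eta `^ (t / 2))).
  apply: lerD.
    rewrite (eq_bigr (fun=> y j `^ s)); last by move=> S _; rewrite ffunE.
    rewrite prod_const; have [->|yj] := eqVneq (y j) 0; first by rewrite powR0 ?gt_eqF.
    apply: ge1r_powR; last by apply: le_trans t2; rewrite ler1n.
    by rewrite lt_neqAle eq_sym yj y0 y_le1.
  apply: (@le_trans _ _ (\sum_(c : labelling k N.+1 | is_cube c && (c != [ffun=> j])) eta `^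
    (t / 2))).
    by apply: ler_sum => c /andP[cc cj]; exact: off_const_term.
  rewrite sumr_const -[_ *+ #|_|]mulr_natl ler_wpM2r ?powR_ge0//.
  apply: le_trans hM; rewrite ler_nat; apply: subset_leq_card.
  by apply/subsetP => c; rewrite !unfold_in => /andP[].
rewrite -lerBrDl -/eta.
have [->|en] := eqVneq eta 0; first by rewrite powR0 ?mulr0// gt_eqF// divr_gt0.
have -> : t / 2 = 1 + (t / 2 - 1) by ring.
rewrite powRD ?en ?implybT// powRr1// mulrCA -[leRHS]mulr1 ler_wpM2l//.
apply: le_trans Md; rewrite ler_wpM2l// ge0_ler_powR ?nnegrE// ?(ltW d0)//.
by rewrite subr_ge0 ler_pdivlMr// mul1r.
Qed.

(** Constant cubes are estimated by the largest mass [z]; for the others the entropy bound is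
    better. *)
Lemma spread_bound (z gam : R) :
  (forall x, y x <= z) ->
  N.+1%:R * z `^ t <= gam ->
  (forall m, (0 < m < N)%N ->
    (N.+1 * ('C(k, m) * N.+1 ^ m))%:R * expR (- (t * nat_entropy R m)) <= gam) ->
  ('C(k, N) * 2 ^ N)%:R * expR (- (t * nat_entropy R N)) + N%:R * gam <= 1 ->
  (0 < N)%N ->
  \sum_(c : labelling k N.+1 | is_cube c) \prod_S y (c S) `^ s <= 1.
Proof.
move=> yz h0 hm hN N0; apply: le_trans hN.
have cls m b b' : (#|[set c : labelling k N.+1 | is_cube c & #|supp c| == m]| <= b)%N ->
    (forall c, is_cube c -> #|supp c| = m -> \prod_S y (c S) `^ s <= b') -> 0 <= b' ->
    \sum_(c : labelling k N.+1 | is_cube c && (#|supp c| == m)) \prod_S y (c S) `^ s <= b%:R *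
      b'.
  move=> hb hb' b0.
  apply: (@le_trans _ _ (\sum_(c : labelling k N.+1 | is_cube c && (#|supp c| == m)) b')).
    by apply: ler_sum => c /andP[cc /eqP cm]; exact: hb'.
  rewrite sumr_const -[_ *+ #|_|]mulr_natl ler_wpM2r// ler_nat; apply: leq_trans hb.
  by apply: subset_leq_card; apply/subsetP => c; rewrite inE unfold_in.
rewrite (partition_big (fun c => inord #|supp c| : 'I_N.+1) predT)//=.
rewrite (eq_bigr (fun m : 'I_N.+1 =>
   \sum_(c : labelling k N.+1 | is_cube c && (#|supp c| == m)) \prod_S y (c S) `^ s));
     last first.
  move=> m _; apply: eq_bigl => c; case: (boolP (is_cube c)) => //= cc.
  by rewrite -(inj_eq val_inj) /= inordK // ltnS card_supp_le.
rewrite big_ord_recr /= addrC; apply: lerD.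
  apply: cls (count_extremal_cubes k N) _ (expR_ge0 _) => c cc cN.
  by rewrite -[X in nat_entropy R X]cN; apply: cube_entropy => //; rewrite y1.
have -> : N%:R * gam = \sum_(i < N) gam by rewrite sumr_const card_ord mulr_natl.
apply: ler_sum => -[[|m] mN] _ /=.
  apply: le_trans h0.
  apply: cls (powR_ge0 _ _); first by have := count_cubes k N 0; rewrite bin0 expn0 !muln1.
  move=> c cc _; rewrite -prod_const; apply: ler_prod => S _.
  rewrite powR_ge0 ge0_ler_powR ?nnegrE ?(ltW s0) ?y0 ?yz//.
  exact: le_trans (y0 (c S)) (yz _).
apply: le_trans (hm m.+1 mN).
apply: cls (count_cubes k N m.+1) _ (expR_ge0 _) => c cc cm.
by rewrite -cm; apply: cube_entropy => //; rewrite y1.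
Qed.
End OneDim.

(** * Choice of the exponent as the dimension of the cube grows *)

Lemma bin_le_expn k m : ('C(k, m) <= k ^ m)%N.
Proof.
elim: m => [|m IH]; first by rewrite bin0.
have h : (m.+1 * 'C(k, m.+1) <= k * k ^ m)%N.
  by rewrite mul_bin_left leq_mul ?leq_subr.
by rewrite expnS; apply: leq_trans h; rewrite leq_pmull.
Qed.

Lemma fact_bin_le k m : ('C(k, m) * m`! <= k ^ m)%N.
Proof.
rewrite bin_ffact; elim: m => [|m IH]; first by rewrite ffactn0.
by rewrite ffactnSr expnSr leq_mul ?leq_subr.
Qed.

Lemma count_all_cubes k N : (0 < k)%N ->
  (#|[pred c : labelling k N.+1 | is_cube c]| <=
    N.+1 * (N.+1 * (k ^ N * N.+1 ^ N)))%N.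
Proof.
move=> k0; rewrite -sum1_card (partition_big (fun c => inord #|supp c| : 'I_N.+1) predT)//=.
rewrite -[X in (_ <= X * _)%N]card_ord -sum_nat_const; apply: leq_sum => m _.
apply: (@leq_trans (N.+1 * ('C(k, m) * N.+1 ^ m))); last first.
  have mN : (m <= N)%N by rewrite -ltnS.
  rewrite leq_mul2l/=; apply: leq_mul; last by rewrite leq_pexp2l.
  by apply: leq_trans (bin_le_expn k m) _; rewrite leq_pexp2l.
apply: leq_trans (count_cubes k N m); rewrite sum1_card.
apply: subset_leq_card; apply/subsetP => c; rewrite unfold_in inE => /andP[cc /eqP e].
have cc' : is_cube c by []; by rewrite inE cc' /= -e inordK // ltnS card_supp_le.
Qed.

Definition critical_exponent (R : realType) (N k : nat) : R :=
  (N%:R * ln (2 * k%:R) - ln N`!%:R) / nat_entropy R N.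
Arguments critical_exponent R N k : clear implicits.

Section Asymptotics.
Local Open Scope classical_set_scope.
Variable R : realType.

Lemma near_ln_ge (M : R) : \forall k \near \oo, M <= ln (k%:R : R).
Proof.
near=> k; have kM : expR M <= k%:R by near: k; exact: nbhs_infty_ger.
rewrite -[M]expRK ler_ln// posrE ?expR_gt0//.
by apply: lt_le_trans kM; exact: expR_gt0.
Unshelve. all: by end_near. Qed.

Lemma near_exp_le (a b g : R) : 0 < a -> 0 < g ->
  \forall k \near \oo, expR (b - a * ln k%:R) <= g.
Proof.
move=> a0 g0; near=> k.
have : (b - ln g) / a <= ln k%:R by near: k; exact: near_ln_ge.
rewrite ler_pdivrMr// => h.
rewrite -[leRHS]lnK ?posrE// ler_expR; lra.
Unshelve. all: by end_near. Qed.

(** With [L = ln k] the exponent is at least [al * L - be].  The threshold [de = expR (- lam)]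
    separating the two regimes is chosen so that [de `^ (t / 2)] beats the total number of
    cubes, of order [k ^ N]; [gam] is the share granted to each class with less than [N] nonzero
    edges, once the class with [N] of them has taken [expR (- (eps * H))]. *)
Lemma near_one_dim N (eps : R) : (0 < N)%N -> 0 < eps ->
  \forall k \near \oo, 2 <= critical_exponent R N k + eps /\
    forall y : 'I_N.+1 -> R, (forall x, 0 <= y x) -> \sum_x y x = 1 ->
    \sum_(c : labelling k N.+1 | is_cube c)
      \prod_S y (c S) `^ ((critical_exponent R N k + eps) / 2 ^+ k) <= 1.
Proof.
move=> N0 e0; pose H := nat_entropy R N.
have H0 : 0 < H by exact: nat_entropy_gt0.
have NR0 : 0 < N%:R :> R by rewrite ltr0n.
pose al := N%:R / H; pose be := ln N`!%:R / H.
have al0 : 0 < al by rewrite divr_gt0.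
have be0 : 0 <= be by rewrite divr_ge0 ?(ltW H0)// ln_ge0// ler1n fact_gt0.
pose lam := 2 * N.+1%:R / al.
have lam0 : 0 < lam by rewrite divr_gt0// mulr_gt0 ?ltr0n.
pose de := expR (- lam); pose z := 1 - de.
have de1 : de < 1 by rewrite expR_lt1 oppr_lt0.
have z0 : 0 < z by rewrite subr_gt0.
have lz0 : ln z < 0 by rewrite ln_lt0// z0 /= gtrBl expR_gt0.
pose D : R := (N.+1 * (N.+1 * N.+1 ^ N))%:R.
have D0 : 0 < D by rewrite ltr0n !muln_gt0 expn_gt0.
pose gam := (1 - expR (- (eps * H))) / N%:R.
have gam0 : 0 < gam by rewrite divr_gt0// subr_gt0 expR_lt1 oppr_lt0 mulr_gt0.
near=> k.
set t := critical_exponent R N k + eps.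
have k0 : (0 < k)%N by near: k; exact: nbhs_infty_gt.
have kR0 : 0 < k%:R :> R by rewrite ltr0n.
have l2 : 0 < ln 2 :> R by rewrite ln_gt0 ?ltr1n.
set L : R := ln k%:R.
have tL : al * L - be <= t.
  rewrite /t /critical_exponent lnM ?posrE ?ltr0n// -/L -/H /al /be.
  rewrite [leLHS](_ : _ = (N%:R * L - ln N`!%:R) / H); last by ring.
  apply: ler_wpDr; first exact: ltW.
  by rewrite ler_pM2r ?invr_gt0// lerB// ler_pM2l// lerDr ltW.
have t2 : 2 <= t.
  apply: le_trans tL; rewrite lerBrDr mulrC -ler_pdivrMr//.
  by rewrite /L; near: k; exact: near_ln_ge.
have kX m : k%:R ^+ m = expR (m%:R * L) by rewrite mulr_natl -lnXn// lnK// posrE exprn_gt0.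
split=> // y y0 y1.
have [[j yj]|spread] := pselect (exists j, 1 - y j <= de).
  apply: (@concentrated_bound _ _ _ _ _ t2 y0 y1 (D * k%:R ^+ N) de j) => //.
  - apply: le_trans (_ : (N.+1 * (N.+1 * (k ^ N * N.+1 ^ N)))%:R <= _).
      by rewrite ler_nat count_all_cubes.
    by rewrite /D !natrM !natrX le_eqVlt; apply/orP; left; apply/eqP; ring.
  - exact: expR_gt0.
  rewrite kX -[D]lnK ?posrE// /de -expRM -!expRD -[leRHS]expR0 ler_expR.
  have h : ln D + lam * (be / 2 + 1) <= L by rewrite /L; near: k; exact: near_ln_ge.
  have e1 : lam * al = 2 * N.+1%:R by rewrite /lam divfK// gt_eqF.
  have : lam * (al * L - be) <= lam * t by rewrite ler_pM2l.
  rewrite mulrBr mulrA e1 -[N.+1%:R]natr1; lra.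
apply: (@spread_bound _ _ _ _ _ t2 y0 y1 z gam) => //.
- move=> x; rewrite leNgt; apply/negP => hx; apply: spread; exists x.
  by move: hx; rewrite /z; lra.
- rewrite /powR gt_eqF// -[N.+1%:R]lnK ?posrE// -expRD.
  have h : expR ((ln N.+1%:R - be * ln z) - (- (al * ln z)) * L) <= gam.
    by rewrite /L; near: k; apply: near_exp_le => //; rewrite oppr_gt0 pmulr_rlt0.
  apply: le_trans h; rewrite ler_expR.
  have : t * ln z <= (al * L - be) * ln z by rewrite ler_nM2r.
  lra.
- move=> m /andP[m0 mN].
  have h : forall m : 'I_N, (0 < m)%N ->
     expR ((ln D + be * nat_entropy R m) - (al * nat_entropy R m - m%:R) * L) <= gam.
    rewrite /L; near: k; apply: filter_forall => i; case: (posnP i) => i0; first by near=> k.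
    have : \forall k \near \oo, expR ((ln D + be * nat_entropy R i) - (al * nat_entropy R i -
      i%:R) * ln k%:R) <= gam.
      apply: near_exp_le => //; rewrite subr_gt0.
      have := @entropy_rate_lt R i N; rewrite i0 ltn_ord => /(_ isT).
      rewrite ltr_pdivlMr ?ltr0n// mulrAC ltr_pdivrMr// /al => h.
      by rewrite mulrAC ltr_pdivlMr// [ltLHS]mulrC [ltRHS]mulrC.
    by apply: filterS => k hk _.
  apply: le_trans (h (Ordinal mN) m0) => /=.
  have hm : 0 < nat_entropy R m by exact: nat_entropy_gt0.
  apply: (@le_trans _ _ (D * k%:R ^+ m * expR (- (t * nat_entropy R m)))).
    rewrite ler_wpM2r ?expR_ge0// /D -natrX -natrM ler_nat -mulnA leq_pmul2l//.
    by rewrite [X in (X <= _)%N]mulnC leq_mul ?bin_le_expn// -expnS leq_pexp2l// leqW// ltnW.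
  rewrite kX -{1}[D]lnK ?posrE// -!expRD ler_expR.
  have : (al * L - be) * nat_entropy R m <= t * nat_entropy R m by rewrite ler_pM2r.
  lra.
rewrite -/H (_ : N%:R * gam = 1 - expR (- (eps * H))); last first.
  by rewrite /gam mulrC divfK// gt_eqF.
rewrite addrCA gerDl subr_le0.
have tH : t * H = N%:R * ln (2 * k%:R) - ln N`!%:R + eps * H.
  by rewrite /t /critical_exponent mulrDl divfK// gt_eqF.
have f0 : 0 < N`!%:R :> R by rewrite ltr0n fact_gt0.
have k20 : 0 < 2 * k%:R :> R by rewrite mulr_gt0 ?ltr0n.
rewrite tH opprD expRD -[leRHS]mul1r mulrA ler_wpM2r ?expR_ge0//.
rewrite opprB expRB lnK ?posrE// [N%:R * _]mulr_natl -lnXn// lnK ?posrE ?exprn_gt0//.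
rewrite mulrA ler_pdivrMr ?exprn_gt0// mul1r -natrM -[2 * _]natrM -natrX ler_nat.
by rewrite mulnAC expnMn mulnC leq_mul2l fact_bin_le orbT.
Unshelve. all: by end_near. Qed.
End Asymptotics.

(** * Upper bound for the number of cubes *)

Section Upper.
Variables (R : realType) (k N : nat) (t : R).
Hypothesis t2 : 2 <= t.
Hypothesis one_dim : forall y : 'I_N.+1 -> R, (forall x, 0 <= y x) -> \sum_x y x = 1 ->
  \sum_(c : labelling k N.+1 | is_cube c) \prod_S y (c S) `^ (t / 2 ^+ k) <= 1.
Let s := t / 2 ^+ k.

Let t0 : 0 < t. Proof. by apply: lt_le_trans t2; rewrite ltr0n. Qed.
Let s0 : 0 < s. Proof. by rewrite divr_gt0// exprn_gt0. Qed.

Lemma one_dim_homogeneous (y : 'I_N.+1 -> R) : (forall x, 0 <= y x) ->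
  \sum_(c : labelling k N.+1 | is_cube c) \prod_S y (c S) `^ s <= (\sum_x y x) `^ t.
Proof.
move=> y0; set Z := \sum_x y x.
have Z0 : 0 <= Z by exact: sumr_ge0.
have [Zz|Zn] := eqVneq Z 0.
  rewrite big1 ?powR_ge0// => c _; rewrite (bigD1 set0)//=.
  suff -> : y (c set0) = 0 by rewrite powR0 ?mul0r// gt_eqF.
  by apply/eqP; have := psumr_eq0P (fun x _ => y0 x) Zz => ->.
have Zp : 0 < Z by rewrite lt_neqAle eq_sym Zn.
have yZ0 x : 0 <= y x / Z by rewrite divr_ge0.
have := one_dim yZ0; rewrite -mulr_suml divff// => /(_ erefl) h.
rewrite (eq_bigr (fun c : labelling k N.+1 => Z `^ t * \prod_S (y (c S) / Z) `^ s)).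
  by rewrite -big_distrr /= -[leRHS]mulr1 ler_wpM2l ?powR_ge0.
move=> c _; rewrite -[Z `^ t](prod_const k) -big_split /=; apply: eq_bigr => S _.
by rewrite -/s -powRM// mulrC divfK.
Qed.

(** Gowers-Cauchy-Schwarz reduces distinct functions to a single one, up to a power [2 ^ k]
    that is then removed. *)
Lemma one_dim_mixed (g : {set 'I_k} -> 'I_N.+1 -> R) : (forall S x, 0 <= g S x) ->
  \sum_(c : labelling k N.+1 | is_cube c) \prod_S g S (c S) `^ s <= \prod_S (\sum_x g S x) `^ s.
Proof.
move=> g0; pose F S x := g S x `^ s.
have := @gowers_CauchySchwarz R k N.+1 F (fun S x => powR_ge0 _ _).
have P0 : 0 <= \prod_S (\sum_x g S x) `^ s by apply: prodr_ge0 => S _; exact: powR_ge0.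
rewrite -/(gowers F) => h.
have T0 : 0 <= gowers F by apply: gowers_ge0 => S x; exact: powR_ge0.
rewrite -(@ler_pXn2r _ (2 ^ k)) ?expn_gt0//.
apply: le_trans h _; rewrite -prodrXl; apply: ler_prod => S _.
rewrite gowers_ge0 /=; last by move=> ? ?; exact: powR_ge0.
rewrite -powR_mulrn ?powR_ge0// -powRrM natrX divfK ?expf_neq0//.
exact: one_dim_homogeneous.
Qed.

Lemma num_cubes_bound d (A : {fset 'rV[int]_d}) : in_grid N.+1 A ->
  (num_cubes k A)%:R <= #|` A|%:R `^ t.
Proof.
move=> gA.
pose row (f : {ffun 'I_d -> 'I_N.+1}) : 'rV[int]_d := \row_i (f i : 'I_N.+1)%:Z.
pose A' := [set f : {ffun 'I_d -> 'I_N.+1} | row f \in A].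
have cA : (#|A'| <= #|` A|)%N.
  rewrite cardE -(size_map row); apply: uniq_leq_size => [|x].
    rewrite map_inj_uniq ?enum_uniq// => f f' e; apply/ffunP => i; apply/val_inj.
    by have := congr1 (fun r : 'rV[int]_d => r ord0 i) e; rewrite !mxE => -[].
  by move=> /mapP[f]; rewrite mem_enum inE => ? ->.
pose v (q : labelling k N.+1) (S : {set 'I_k}) := q S.
have := @tensorization R _ _ _ (@is_cube k N.+1) v s one_dim_mixed d (fun=> A').
rewrite prod_const => h.
apply: (@le_trans _ _ (#|A'|%:R `^ t)); last first.
  by apply: ge0_ler_powR; rewrite ?nnegrE ?ler_nat// ltW.
apply: le_trans h; rewrite ler_nat /num_cubes cardfE.
set K := fset_set _.
pose vtx (ah : 'rV[int]_d * {ffun 'I_k -> 'rV[int]_d}) (S : {set 'I_k}) :=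
  ah.1 + \sum_(l in S) ah.2 l.
have KA (ah : K) S : vtx (val ah) S \in A.
  have := valP ah; rewrite in_fset_set; last exact: finite_cubes.
  move/set_mem => /(_ [ffun l => l \in S]); congr (_ \in A); congr (_ + _).
  rewrite [RHS]big_mkcond; apply: eq_bigr => l _; rewrite ffunE.
  by case: (l \in S); rewrite ?mulr1n ?mulr0n.
pose f (ah : K) : {ffun 'I_d -> labelling k N.+1} :=
  [ffun i => [ffun S => inord (absz (vtx (val ah) S ord0 i))]].
have fE ah i S : (f ah i S)%:Z = vtx (val ah) S ord0 i.
  have /andP[] := gA _ (KA ah S) i; rewrite !ffunE.
  case: (vtx _ _ _ _) => // z _ zN /=; congr Posz.
  by rewrite inordK.
have f_inj : injective f.
  move=> x x' e; apply/val_inj.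
  have e' S : vtx (val x) S = vtx (val x') S.
    by apply/rowP => i; rewrite -!fE e.
  have e1 : (val x).1 = (val x').1.
    by have := e' set0; rewrite /vtx !big_set0 !addr0.
  rewrite [LHS]surjective_pairing [RHS]surjective_pairing e1; congr pair.
  apply/ffunP => l; have := e' [set l]; rewrite /vtx !big_set1 e1.
  exact: addrI.
rewrite -(card_imset _ f_inj); apply: subset_leq_card; apply/subsetP => _ /imsetP[x _ ->].
rewrite inE; apply/andP; split; apply/forallP.
  move=> i; have [] // := @cube_intro _ _ (f x i) ((val x).1 ord0 i) (fun l => (val x).2 l
    ord0 i).
  by move=> S; rewrite fE /vtx mxE summxE.
move=> S; rewrite inE; have := KA x S; congr (_ \in A).
by apply/rowP => i; rewrite [RHS]mxE ffunE fE.
Qed.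
End Upper.

(** * Lower bound from type classes *)

Section Multinomial.
Variables (Q : finType) (L : nat).
Local Notation D := (Q * 'I_L)%type.

Definition relabel (s : {perm D}) : {ffun D -> Q} := [ffun x => (s x).1].

(** Such a permutation acts on each fibre of the first projection separately. *)
Lemma card_fst_preserving :
  (#|[set s : {perm D} | [forall x, (s x).1 == x.1]]| <= L`! ^ #|Q|)%N.
Proof.
pose f (s : {perm D}) : {ffun Q -> {ffun 'I_L -> 'I_L}} := [ffun q => [ffun l => (s (q, l)).2]].
pose I := [set g : {ffun 'I_L -> 'I_L} | injectiveb g].
have -> : (L`! ^ #|Q|)%N = #|(ffun_on (mem I) : {pred {ffun Q -> {ffun 'I_L -> 'I_L}}})|.
  by rewrite card_ffun_on card_inj_ffuns card_ord ffactnn.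
rewrite -(card_in_imset (f := f)); last first.
  move=> s s'; rewrite !inE => /forallP h /forallP h' e; apply/permP => -[q l].
  rewrite [LHS]surjective_pairing [RHS]surjective_pairing (eqP (h _)) (eqP (h' _)) /=;
    congr pair.
  have := congr1 (fun g : {ffun Q -> {ffun 'I_L -> 'I_L}} => g q l) e.
  by rewrite !ffunE.
apply: subset_leq_card; apply/subsetP => g /imsetP[s]; rewrite inE => /forallP h ->.
apply/ffun_onP => q; rewrite inE; apply/injectiveP => l l'; rewrite !ffunE => e.
have : s (q, l) = s (q, l').
  rewrite [LHS]surjective_pairing [RHS]surjective_pairing.
  by rewrite (eqP (h _)) (eqP (h (q, l'))) e.
by move=> /perm_inj [].
Qed.

(** The multinomial coefficient [(L * #|Q|)! / L! ^ #|Q|] as a number of words: permutations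
    of [Q * 'I_L] are mapped to words in which each letter of [Q] occurs [L] times, and two
    with the same word differ by a permutation that preserves the letters. *)
Lemma card_relabel : ((L * #|Q|)`! <= #|[set relabel s | s : {perm D}]| * L`! ^ #|Q|)%N.
Proof.
have cD : #|{: {perm D}}| = (L * #|Q|)`!.
  have := @card_perm D setT; rewrite cardsT card_prod card_ord mulnC => <-.
  by apply/esym/eq_card => s; rewrite !inE; apply/subsetP => x; rewrite inE.
rewrite -cD -[X in (X <= _)%N]sum1_card (partition_big relabel (mem [set relabel s | s : {perm
  D}])) /=; last first.
  by move=> s _; apply: imset_f.
rewrite -sum_nat_const; apply: leq_sum => c /imsetP[s0 _ ->].
apply: leq_trans card_fst_preserving; rewrite sum1_card.
rewrite -(card_imset _ (mulgI s0^-1)%g); apply: subset_leq_card.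
apply/subsetP => _ /imsetP[s es ->]; rewrite inE; apply/forallP => x.
have {es} es : relabel s = relabel s0 by exact/eqP.
have := congr1 (fun g : {ffun D -> Q} => g (s0^-1 x)%g) es.
by rewrite !ffunE permM permKV => ->.
Qed.
End Multinomial.

Lemma fact_ratio m K : (m`! * m ^ K <= (m + K)`!)%N.
Proof.
elim: K => [|K IH]; first by rewrite muln1 addn0.
by rewrite addnS factS expnS mulnCA leq_mul// leqW// leq_addr.
Qed.

(** An elementary substitute for Stirling's formula. *)
Lemma multinomial_ge K L : (0 < L)%N ->
  (K ^ (K * L.-1) * L`! ^ K <= (L * K)`! * L ^ K)%N.
Proof.
case: L => // L _; elim: L => [|L IH] /=.
  by rewrite muln0 expn0 !exp1n mul1n muln1 mul1n fact_gt0.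
have := fact_ratio (L.+1 * K) K; rewrite -mulSnr => h.
apply: (@leq_trans ((L.+1 * K)`! * (L.+1 * K) ^ K * L.+2 ^ K));
  last by rewrite leq_mul2r h orbT.
rewrite [L.+2`!]factS; move: IH; rewrite [_.-1]/=; set f := (L.+1)`!; clearbody f => IH.
rewrite mulnS expnD !expnMn mulnACA.
apply: leq_trans (leq_mul (leqnn _) IH) _; rewrite eq_leq//.
by set x := (_ `!)%N; set y := (K ^ K)%N; set z := (L.+2 ^ K)%N; set w := (L.+1 ^ K)%N; ring.
Qed.

Section TypeClass.
Variables (R : realType) (D : finType) (N a : nat).

(** For [#|D| = a * 2 ^ N] these are the vectors whose empirical distribution is binomial. *)
Definition type_class : {set {ffun D -> 'I_N.+1}} :=
  [set f : {ffun D -> 'I_N.+1} | [forall m : 'I_N.+1, #|[pred x | f x == m]| == (a * 'C(N,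
    m))%N]].

(** Under the product of binomial distributions all vectors of binomial type have the same
    probability. *)
Lemma card_type_class : #|type_class|%:R <= expR ((a * 2 ^ N)%:R * nat_entropy R N).
Proof.
pose p (m : 'I_N.+1) : R := 'C(N, m)%:R / 2 ^+ N.
have p0 m : 0 < p m by rewrite divr_gt0 ?exprn_gt0// ltr0n bin_gt0 -ltnS.
have p1 : \sum_m p m = 1.
  by rewrite -big_distrl /= -natr_sum sum_bin natrX mulfV ?expf_neq0.
have e1 : \sum_(f : {ffun D -> 'I_N.+1}) \prod_x p (f x) = 1.
  rewrite -(bigA_distr_bigA (fun _ : D => p)) /=.
  by rewrite big1.
suff e2 f : f \in type_class -> \prod_x p (f x) = expR (- ((a * 2 ^ N)%:R * nat_entropy R N)).
  set E := _ * nat_entropy R N in e2 *.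
  suff : #|type_class|%:R * expR (- E) <= 1 by rewrite expRN ler_pdivrMr ?expR_gt0// mul1r.
  rewrite -[leRHS]e1 (bigID (mem type_class)) /= (eq_bigr _ e2) sumr_const mulr_natl.
  by rewrite lerDl sumr_ge0// => f _; apply: prodr_ge0 => x _; exact: ltW.
rewrite inE => /forallP fT.
rewrite (partition_big f predT)//=.
rewrite (eq_bigr (fun m : 'I_N.+1 => expR ((a * 'C(N, m))%:R * ln (p m)))); last first.
  move=> m _; rewrite (eq_bigr (fun=> p m)); last by move=> x /eqP ->.
  rewrite prodr_const (eqP (fT m)) mulr_natl -lnXn// lnK// posrE exprn_gt0//.
rewrite -expR_sum; congr expR.
rewrite (eq_bigr (fun m : 'I_N.+1 => a%:R * (ln 'C(N, m)%:R *+ 'C(N, m)) -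
    a%:R * (N%:R * ln 2) * 'C(N, m)%:R)); last first.
  move=> m _; have mN : (m <= N)%N by rewrite -ltnS.
  rewrite /p ln_div ?posrE ?exprn_gt0// ?ltr0n ?bin_gt0 ?mN//.
  rewrite lnXn// natrM -[ln 2 *+ N]mulr_natl -[_ *+ 'C(N, m)]mulr_natl; ring.
rewrite sumrB -!big_distrr /= -natr_sum sum_bin natrX /nat_entropy natrM natrX.
set b := 2 ^+ N; have b0 : b != 0 by rewrite expf_neq0.
by field.
Qed.
End TypeClass.

(** For [E] and [S] fixed, [F |-> (S symmetric difference F) :&: E] is an involution of the
    subsets of [E].  Hence each vertex is binomially distributed when [F] is uniform. *)
Lemma card_signed_sets_vertex k N (S : {set 'I_k}) (m : nat) :
  #|[set p in signed_sets k N | #|[set l in p.1 | (l \in S) (+) (l \in p.2)]| == m]| =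
  ('C(k, N) * 'C(N, m))%N.
Proof.
rewrite -sum1_card (eq_bigl (fun p : {set 'I_k} * {set 'I_k} =>
  (p \in signed_sets k N) && (#|[set l in p.1 | (l \in S) (+) (l \in p.2)]| == m))); last first.
  by move=> p; rewrite inE.
rewrite big_mkcondr.
rewrite (sum_signed_sets N (fun E F => if #|[set l in E | (l \in S) (+) (l \in F)]| == m then
  1 else 0)%N).
rewrite -card_sets_of_card -sum_nat_const; apply: eq_bigr => E /eqP EN.
pose sw (F : {set 'I_k}) := [set l in E | (l \in S) (+) (l \in F)].
have swsw (F : {set 'I_k}) : F \subset E -> sw (sw F) = F.
  move=> /subsetP FE; apply/setP => l; rewrite !inE.
  have := FE l; case: (l \in E) => /=; first by rewrite addKb.
  by case: (l \in F) => // /(_ isT).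
rewrite -big_mkcondr /= (reindex_onto sw sw) /=; last first.
  by move=> F /andP[]; rewrite powersetE => FE _; exact: swsw.
rewrite sum1_card -EN -cards_draws; apply: eq_card => F; rewrite [RHS]inE.
apply: (etrans (y := [&& sw F \in powerset E, #|sw (sw F)| == m & sw (sw F) == F]));
  first by rewrite andbA.
apply/idP/idP => [/and3P[_ h /eqP e]|/andP[FE h]].
  have : sw (sw F) \subset E by apply/subsetP => l; rewrite inE => /andP[].
  by rewrite e in h *; rewrite h => ->.
by rewrite (swsw _ FE) eqxx h !andbT powersetE; apply/subsetP => l; rewrite inE => /andP[].
Qed.

Section Lower.
Variables (R : realType) (k N L : nat) (t : R).
Hypothesis (t0 : 0 < t).
Hypothesis (Nk : (N <= k)%N) (L0 : (0 < L)%N).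
Hypothesis adm : forall (d : nat) (A : {fset 'rV[int]_d}),
     (0 < d)%N -> in_grid N.+1 A -> (num_cubes k A)%:R <= (#|` A|)%:R `^ t.

Let Q := {p : {set 'I_k} * {set 'I_k} | p \in signed_sets k N}.
Let D := (Q * 'I_L)%type.
Let d := #|{: D}|.

Lemma card_Q : #|{: Q}| = ('C(k, N) * 2 ^ N)%N.
Proof. by rewrite card_sig -card_signed_sets; apply: eq_card => p; rewrite !inE. Qed.

Lemma card_Q_gt0 : (0 < #|{: Q}|)%N.
Proof. by rewrite card_Q muln_gt0 bin_gt0 Nk expn_gt0. Qed.

Let row (f : {ffun D -> 'I_N.+1}) : 'rV[int]_d := \row_i (f (enum_val i))%:Z.

Lemma grid_row_inj : injective row.
Proof.
move=> f f' e; apply/ffunP => x; apply/val_inj.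
have := congr1 (fun r : 'rV[int]_d => r ord0 (enum_rank x)) e.
by rewrite !mxE enum_rankK => -[].
Qed.

Let T : {set {ffun D -> 'I_N.+1}} := type_class D N (L * 'C(k, N)).
Let A : {fset 'rV[int]_d} := [fset row f | f in T]%fset.

Let base (q : Q) : int := #|(val q).2|%:Z.
Let step (q : Q) (l : 'I_k) : int :=
  if l \in (val q).1 then (if l \in (val q).2 then -1 else 1) else 0.
Let pos (q : Q) (S : {set 'I_k}) : nat :=
  #|[set l in (val q).1 | (l \in S) (+) (l \in (val q).2)]|.

Lemma vertexE q S : (pos q S)%:Z = base q + \sum_(l in S) step q l.
Proof.
case: q => -[E F] /= h; rewrite /pos /base /step /=.
have FE : {subset F <= E} by move: h; rewrite inE => /andP[_ /subsetP].
rewrite -!sum1_card !(big_morph Posz PoszD (erefl _)).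
rewrite [LHS]big_mkcond [X in X + _]big_mkcond [X in _ + X]big_mkcond -big_split.
apply: eq_bigr => l _; rewrite inE; have := FE l.
by case: (l \in E); case: (l \in F); case: (l \in S) => //= /(_ isT).
Qed.

Lemma vertex_lt q S : (pos q S < N.+1)%N.
Proof.
have := valP q; rewrite inE => /andP[/eqP EN _]; rewrite ltnS -[leqRHS]EN.
by apply: subset_leq_card; apply/subsetP => l; rewrite inE => /andP[].
Qed.

Let cube (c : {ffun D -> Q}) : 'rV[int]_d * {ffun 'I_k -> 'rV[int]_d} :=
  (\row_i base (c (enum_val i)), [ffun l => \row_i step (c (enum_val i)) l]).

Lemma cube_inj : injective cube.
Proof.
move=> c c' [e1 e2]; apply/ffunP => x; apply/val_inj.
have es l : step (c x) l = step (c' x) l.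
  have := congr1 (fun h : {ffun 'I_k -> 'rV[int]_d} => h l ord0 (enum_rank x)) e2.
  by rewrite !ffunE !mxE enum_rankK.
have sub (q : Q) : {subset (val q).2 <= (val q).1}.
  by have := valP q; rewrite inE => /andP[_ /subsetP].
rewrite [LHS]surjective_pairing [RHS]surjective_pairing; congr pair; apply/setP => l.
  by have := es l; rewrite /step; case: (l \in (val (c x)).1);
    case: (l \in (val (c x)).2); case: (l \in (val (c' x)).1); case: (l \in (val (c' x)).2).
have := es l; have := sub (c x) l; have := sub (c' x) l; rewrite /step.
case: (l \in (val (c x)).1); case: (l \in (val (c x)).2); case: (l \in (val (c' x)).1);
case: (l \in (val (c' x)).2) => //= h1 h2;
  first [by have := h1 isT | by have := h2 isT | by []].
Qed.

Lemma vertex_in_class (s : {perm D}) (S : {set 'I_k}) :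
  [ffun x => Ordinal (vertex_lt (relabel s x) S)] \in T.
Proof.
rewrite inE; apply/forallP => m; apply/eqP.
transitivity #|[pred x : D | pos x.1 S == m]|.
  rewrite -[RHS](card_imset _ (@perm_inj _ s^-1%g)).
  apply: eq_card => x; rewrite [LHS]inE ffunE; set u := Ordinal _;
    rewrite -(inj_eq val_inj) {}/u /= ffunE.
  apply/eqP/imsetP => [e|[z + ->]]; last by rewrite inE permKV => /eqP.
  by exists (s x); rewrite ?permK// inE e.
transitivity (#|[pred q : Q | pos q S == m]| * L)%N.
  rewrite -[in RHS](card_ord L) -cardX; apply: eq_card => x.
  by rewrite !inE andbT.
rewrite mulnC -mulnA; congr (_ * _)%N; rewrite -(card_signed_sets_vertex N S m).
rewrite -(card_imset _ (@val_inj _ _ Q)); apply: eq_card => p; rewrite [RHS]inE.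
apply/imsetP/andP => [[q qm ->]|[pQ pm]]; first by split; [exact: valP|exact: qm].
by exists (Sub p pQ).
Qed.

Lemma num_cubes_relabel : (#|[set relabel s | s : {perm D}]| <= num_cubes k A)%N.
Proof.
rewrite /num_cubes cardE -(size_map cube).
apply: uniq_leq_size => [|_ /mapP[c + ->]]; first by rewrite map_inj_uniq ?enum_uniq//;
  exact: cube_inj.
rewrite mem_enum => /imsetP[s _ ->].
rewrite in_fset_set; last exact: finite_cubes.
apply/mem_set => eps; apply/imfsetP.
exists [ffun x => Ordinal (vertex_lt (relabel s x) [set l | eps l])];
  first exact: vertex_in_class.
apply/rowP => i; rewrite [RHS]mxE ffunE /= vertexE [LHS]mxE mxE summxE; congr (_ + _).
rewrite [RHS]big_mkcond; apply: eq_bigr => l _; rewrite inE ffunE.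
by case: (eps l); rewrite ?mulr1n ?mulr0n mxE.
Qed.

(** The cubes given by words in which every letter occurs [L] times are compared with the
    number of vectors of binomial type. *)
Lemma entropy_lower_finite :
  (L.-1)%:R * ln ('C(k, N) * 2 ^ N)%:R <= ln L%:R + t * L%:R * nat_entropy R N.
Proof.
have K0 := card_Q_gt0; rewrite -card_Q; set K := #|{: Q}| in K0 *.
have d0 : (0 < d)%N by rewrite /d card_prod card_ord muln_gt0 K0.
have gA : in_grid N.+1 A.
  by move=> _ /imfsetP[f _ ->] i; rewrite mxE /= ltz_nat ltn_ord.
have cA : #|` A| = #|T| by rewrite card_imfset /= ?cardE//; exact: grid_row_inj.
have h1 := adm d0 gA; have h2 := num_cubes_relabel.
have h3 : (K ^ (K * L.-1) <= num_cubes k A * L ^ K)%N.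
  have := leq_trans (multinomial_ge K L0) (leq_mul (card_relabel Q L) (leqnn _)).
  rewrite mulnAC leq_pmul2r ?expn_gt0 ?fact_gt0// => h; apply: leq_trans h _.
  by rewrite leq_mul2r h2 orbT.
have h4 : (#|` A|)%:R `^ t <= expR (t * (L * K)%:R * nat_entropy R N).
  rewrite cA; apply: le_trans (_ : expR ((L * 'C(k, N) * 2 ^ N)%:R * nat_entropy R N) `^ t <=
    _).
    by apply: ge0_ler_powR; rewrite ?nnegrE ?expR_ge0 ?card_type_class// ltW.
  by rewrite -expRM ler_expR /K card_Q mulnA mulrC mulrA.
have KR0 : 0 < K%:R :> R by rewrite ltr0n.
have LR0 : 0 < L%:R :> R by rewrite ltr0n.
have h5 : K%:R ^+ (K * L.-1) <= expR (t * (L * K)%:R * nat_entropy R N) * L%:R ^+ K.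
  apply: (@le_trans _ _ (num_cubes k A * L ^ K)%:R); first by rewrite -natrX ler_nat.
  by rewrite natrM natrX ler_wpM2r ?exprn_ge0// (le_trans h1).
rewrite -ler_ln ?posrE ?mulr_gt0 ?exprn_gt0 ?expR_gt0// in h5; move: h5.
rewrite lnM ?posrE ?exprn_gt0 ?expR_gt0// expRK !lnXn// mulnC mulrnA -[_ *+ L.-1]mulr_natl
  natrM.
rewrite -[ln L%:R *+ K]mulr_natl -[_ *+ K]mulr_natl => h.
rewrite -(ler_pM2l KR0); lra.
Qed.
End Lower.

(** Dividing [entropy_lower_finite] by [L] and letting [L] tend to infinity.  The squares
    [L = M * M] make the bound [ln M <= M] sufficient. *)
Lemma entropy_lower (R : realType) (k N : nat) (t : R) :
  0 < t -> (N <= k)%N ->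
  (forall (d : nat) (A : {fset 'rV[int]_d}),
     (0 < d)%N -> in_grid N.+1 A -> (num_cubes k A)%:R <= (#|` A|)%:R `^ t) ->
  ln ('C(k, N) * 2 ^ N)%:R <= t * nat_entropy R N.
Proof.
move=> t0 Nk adm; rewrite leNgt; apply/negP => lt.
set K := ln _ in lt; set H := nat_entropy R N in lt.
have K0 : 0 <= K by rewrite ln_ge0// ler1n muln_gt0 bin_gt0 Nk expn_gt0.
pose e := K - t * H; have e0 : 0 < e by rewrite subr_gt0.
pose M := (Num.bound ((2 + K) / e)).+1.
have M1 : 1 <= M%:R :> R by rewrite ler1n.
have Me : 2 + K < M%:R * e.
  have h0 : 0 <= (2 + K) / e by apply: divr_ge0; [exact: addr_ge0|exact: ltW].
  rewrite -ltr_pdivrMr//; apply: lt_trans (archi_boundP h0) _.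
  by rewrite ltr_nat.
have := @entropy_lower_finite R k N (M * M) t t0 Nk isT adm.
rewrite -/K -/H -subn1 natrB// natrM.
have lM : ln M%:R <= M%:R :> R by rewrite ltW// ln_sublinear// ltr0n.
rewrite lnM ?posrE ?ltr0n// => h.
have h' : M%:R * M%:R * e <= 2 * M%:R + K by rewrite /e; lra.
have : M%:R * (2 + K) < M%:R * (M%:R * e) by rewrite ltr_pM2l// ltr0n.
have : K <= M%:R * K by rewrite ler_peMl.
rewrite mulrA; lra.
Qed.

(** * The limit *)

Lemma expn_le_ffact k N m : (m <= N)%N -> ((k - N) ^ m <= k ^_ m)%N.
Proof.
elim: m => [|m IH] mN; first by rewrite ffactn0.
by rewrite expnSr ffactnSr leq_mul ?IH ?leq_sub2l// ltnW.
Qed.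

Lemma binomial_entropyE (R : realType) m :
  binomial_entropy R m = nat_entropy R m / ln 2.
Proof.
have l2 : 0 < ln 2 :> R by rewrite ln_gt0 ?ltr1n.
rewrite /binomial_entropy big_mkord.
rewrite (eq_bigr (fun j : 'I_m.+1 => (ln 'C(m, j)%:R *+ 'C(m, j)) / (2 ^+ m * ln 2)
    - (m%:R / 2 ^+ m) * 'C(m, j)%:R)); last first.
  move=> j _; have jm : (j <= m)%N by rewrite -ltnS.
  rewrite /log2 ln_div ?posrE ?exprn_gt0// ?ltr0n ?bin_gt0// lnXn//.
  rewrite -[ln 2 *+ m]mulr_natl -[_ *+ 'C(m, j)]mulr_natl; set p := 2 ^+ m.
  have p0 : p != 0 by rewrite expf_neq0.
  by field; rewrite p0 gt_eqF.
rewrite sumrB -big_distrl -big_distrr /= -natr_sum sum_bin natrX /nat_entropy.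
set p := 2 ^+ m; have p0 : p != 0 by rewrite expf_neq0.
by field; rewrite p0 gt_eqF.
Qed.

Lemma critical_exponentE (R : realType) N k : (0 < N)%N ->
  (N%:R * log2 (2 * k%:R) - log2 N`!%:R) / binomial_entropy R N = critical_exponent R N k.
Proof.
move=> N0; have l2 : 0 < ln 2 :> R by rewrite ln_gt0 ?ltr1n.
have H0 := nat_entropy_gt0 R N0.
by rewrite binomial_entropyE /critical_exponent /log2; field; rewrite !gt_eqF.
Qed.

Local Open Scope classical_set_scope.

(** The falling factorial [k ^_ N] is at least [(k - N) ^ N], and [ln k - ln (k - N)] is at
    most [N / (k - N)]. *)
Lemma near_log_binomial (R : realType) N (eps : R) : 0 < eps ->
  \forall k \near \oo, (N <= k)%N /\
    N%:R * ln (2 * k%:R) - ln N`!%:R - eps <= ln ('C(k, N) * 2 ^ N)%:R :> R.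
Proof.
move=> e0; near=> k.
have Nk : (N < k)%N by near: k; exact: nbhs_infty_gt.
have kN : N%:R + N%:R * N%:R / eps <= k%:R :> R by near: k; exact: nbhs_infty_ger.
split; first exact: ltnW.
have k0 : 0 < k%:R :> R by rewrite ltr0n (leq_ltn_trans _ Nk).
have d0 : 0 < (k - N)%:R :> R by rewrite ltr0n subn_gt0.
have kd : k%:R = (k - N)%:R + N%:R :> R by rewrite -natrD subnK// ltnW.
have B0 : 0 < 'C(k, N)%:R :> R by rewrite ltr0n bin_gt0 ltnW.
have F0 : 0 < N`!%:R :> R by rewrite ltr0n fact_gt0.
have h1 : N%:R * ln (k - N)%:R <= ln 'C(k, N)%:R + ln N`!%:R :> R.
  rewrite -lnM ?posrE// -natrM bin_ffact mulr_natl -lnXn// ler_ln ?posrE ?exprn_gt0//.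
    by rewrite -natrX ler_nat expn_le_ffact.
  by rewrite ltr0n ffact_gt0 ltnW.
have h2 : ln k%:R - ln (k - N)%:R <= N%:R / (k - N)%:R :> R.
  rewrite -ln_div ?posrE//; apply: le_trans (ln_le_subr1 _) _; first exact: divr_gt0.
  by rewrite kd mulrDl divff ?gt_eqF// addrC addKr.
have h3 : N%:R * (N%:R / (k - N)%:R) <= eps :> R.
  rewrite mulrA ler_pdivrMr// [leRHS]mulrC -ler_pdivrMr//; lra.
have h4 : N%:R * (ln k%:R - ln (k - N)%:R) <= N%:R * (N%:R / (k - N)%:R) :> R by rewrite
  ler_wpM2l.
rewrite natrM natrX !lnM ?posrE ?exprn_gt0// lnXn// -[_ *+ N]mulr_natl; lra.
Unshelve. all: by end_near. Qed.

Theorem theorem4 (R : realType) (n : nat) (hn : (2 <= n)%N) :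
  (fun k : nat =>
     least_exponent R k n
     - (n.-1%:R * log2 (2 * k%:R) - log2 (n.-1)`!%:R)
       / binomial_entropy R n.-1) @ \oo --> (0 : R).
Proof.
case: n hn => // N; rewrite ltnS => N0 /=.
have H0 := nat_entropy_gt0 R N0.
apply/cvgrPdist_le => eps e0; near=> k.
rewrite critical_exponentE// sub0r normrN ler_norml.
have [adm least] := @least_exponentP R k N.+1 N0.
apply/andP; split; last first.
  rewrite lerBlDl; apply: least.
  have [t2 one_dim] : 2 <= critical_exponent R N k + eps /\
    forall y : 'I_N.+1 -> R, (forall x, 0 <= y x) -> \sum_x y x = 1 ->
    \sum_(c : labelling k N.+1 | is_cube c)
      \prod_S y (c S) `^ ((critical_exponent R N k + eps) / 2 ^+ k) <= 1.
    by near: k; exact: near_one_dim.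
  split; first by apply: lt_le_trans t2; rewrite ltr0n.
  by move=> d A _ gA; exact: num_cubes_bound gA.
have [Nk big] : (N <= k)%N /\
    N%:R * ln (2 * k%:R) - ln N`!%:R - eps * nat_entropy R N <= ln ('C(k, N) * 2 ^ N)%:R :> R.
  by near: k; apply: near_log_binomial; exact: mulr_gt0.
have := entropy_lower adm.1 Nk adm.2 => low.
rewrite lerBrDr -(ler_pM2r H0) mulrDl /critical_exponent divfK ?gt_eqF//.
by apply: le_trans low; move: big; rewrite mulNr; lra.
Unshelve. all: by end_near. Qed.
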